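(* Let $M$ be a connected Riemann surface and let $\varphi:M\to G_k(\mathbb{C}^n)$ be a harmonic map of finite uniton number and finite isotropy order, with first return map $\mathbf{c}$ of nilorder $p\ge2$ and second return map $\mathbf{e}$. Let $\alpha$ be a holomorphic subbundle of $\varphi$ with $\operatorname{Im}\mathbf{c}^{p-1}\subseteq\alpha\subseteq\ker\mathbf{c}$. Then the bundle map $$\mathbf{E}_{p-1}=\mathbf{c}^{p-1}\circ\mathbf{e}|_\alpha:\alpha\to\alpha$$ is nilpotent.
   Context: $M$ is a connected Riemann surface (not necessarily compact), $z$ a local complex coordinate, $\partial_z,\partial_{\bar z}$ the ordinary (flat) derivatives in $\mathbb{C}^n$. A smooth map $\varphi:M\to G_k(\mathbb{C}^n)$ is identified with the rank-$k$ subbundle of $M\times\mathbb{C}^n$ with fibre $\varphi(z)$ at $z$. $\pi_\psi$ is orthogonal projection onto $\psi$, $\psi^\perp$ the orthogonal complement, $\Gamma(\cdot)$ the smooth sections. A subbundle $\beta$ of $\varphi$ is holomorphic if $\Gamma(\beta)$ is closed under $\pi_\varphi\circ\partial_{\bar z}$. For mutually orthogonal subbundles $\psi,\chi$, the second fundamental form is $A'_{\psi,\chi}=\pi_\chi\circ\partial_z|_\psi:\psi\to\chi$ (a bundle map); $A'_\psi=A'_{\psi,\psi^\perp}$. Images and kernels of bundle maps are understood as extended to subbundles over the isolated points where the rank drops (''filling out zeros''). For $\varphi$ harmonic, $G'(\varphi)=\operatorname{Im}A'_\varphi$, $G^{(0)}(\varphi)=\varphi$, $G^{(i+1)}(\varphi)=G'(G^{(i)}(\varphi))$.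 The isotropy order of $\varphi$ is the greatest $r\in\{1,2,\ldots,\infty\}$ such that $\varphi\perp G^{(i)}(\varphi)$ for all $1\le i\le r$; then $G^{(i)}(\varphi)\perp G^{(j)}(\varphi)$ whenever $1\le|i-j|\le r$. For $\varphi$ of finite isotropy order $r$, put $R=\bigl(\sum_{i=0}^rG^{(i)}(\varphi)\bigr)^\perp$. The first return map is the bundle map $\varphi\to\varphi$ $$\mathbf{c}=A'_{G^{(r)}(\varphi),\varphi}\circ A'_{G^{(r-1)}(\varphi)}\circ\cdots\circ A'_{G^{(1)}(\varphi)}\circ A'_\varphi,$$ and the second return map is the bundle map $\varphi\to\varphi$ $$\mathbf{e}=A'_{R,\varphi}\circ A'_{G^{(r)}(\varphi),R}\circ A'_{G^{(r-1)}(\varphi)}\circ\cdots\circ A'_{G^{(1)}(\varphi)}\circ A'_\varphi .$$ These are defined on each coordinate chart; a change of coordinate multiplies them by nowhere-zero functions. The nilorder of $\mathbf{c}$ is the least $p$ with $\mathbf{c}^p=0$. Finite uniton number: for smooth $\varphi:M\to U(n)$ put $A^\varphi_z=\frac12\varphi^{-1}\partial_z\varphi$, $A^\varphi_{\bar z}=\frac12\varphi^{-1}\partial_{\bar z}\varphi$. A uniton for a harmonic $\varphi:M\to U(n)$ is a subbundle $\alpha$ of $M\times\mathbb{C}^n$ with $\Gamma(\alpha)$ closed under $\partial_{\bar z}+A^\varphi_{\bar z}$ and under $A^\varphi_z$. $\varphi$ is of finite uniton number if $\varphi=\varphi_0(\pi_{\alpha_1}-\pi_{\alpha_1}^\perp)\cdots(\pi_{\alpha_s}-\pi_{\alpha_s}^\perp)$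 for some $s\ge0$, with $\varphi_0\in U(n)$ constant and each $\alpha_i$ a uniton for the partial product of the first $i-1$ factors (times $\varphi_0$). A map $\varphi:M\to G_k(\mathbb{C}^n)$ is of finite uniton number if $\pi_\varphi-\pi_\varphi^\perp:M\to U(n)$ is. *)

(* Defs.v *)
From mathcomp Require Import all_boot all_order all_algebra.
From mathcomp Require Import all_classical all_reals all_analysis.
From mathcomp Require Import complex.

Set Implicit Arguments.
Unset Strict Implicit.
Unset Printing Implicit Defensive.

Import Order.TTheory GRing.Theory Num.Theory.
Import numFieldNormedType.Exports.

Local Open Scope classical_set_scope.
Local Open Scope ring_scope.
Local Open Scope complex_scope.
Local Open Scope sesquilinear_scope.

(* R[i] carries its topology and its normed structure over itself through the
   alias R[i]^o, so coordinates live in R[i]^o; derivable at R[i]^o is complex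
   differentiability.

   Charts are total functions, only meaningful on cdom (for cmap) and on
   cmap @` cdom (for cinv).  Second countability is not required: it is
   automatic for a connected surface (Rado). *)
Record riemann_surface (R : realType) := RiemannSurface {
  rs_space :> topologicalType;
  rs_hausdorff : hausdorff_space rs_space;
  chart : Type;
  cdom : chart -> set rs_space;
  cmap : chart -> rs_space -> R[i]^o;
  cinv : chart -> R[i]^o -> rs_space;
  cdom_cover : forall x, exists c, cdom c x;
  cdom_open : forall c, open (cdom c);
  cimg_open : forall c, open (cmap c @` cdom c);
  cmapK : forall c x, cdom c x -> cinv c (cmap c x) = x;
  cmap_continuous : forall c x, cdom c x -> {for x, continuous (cmap c)};
  cinv_continuous : forall c z, (cmap c @` cdom c) z ->
    {for z, continuous (cinv c)};
  transition_holomorphic : forall c d z,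
    (cmap c @` (cdom c `&` cdom d)) z -> derivable (cmap d \o cinv c) z 1 }.

Section PlaneCalculus.
Context {R : realType}.
Implicit Types (f : R[i]^o -> R[i]^o) (v z : R[i]^o) (U : set R[i]^o).

(* Real directional derivative; v = 1 is d/dx and v = 'i is d/dy. *)
Definition dir_derivable v f z : Prop :=
  derivable (fun t : R => complex.Re (f (z + t%:C * v))) 0 1 /\
  derivable (fun t : R => complex.Im (f (z + t%:C * v))) 0 1.

Definition dir_deriv v f z : R[i]^o :=
  (derive1 (fun t : R => complex.Re (f (z + t%:C * v))) 0) +i*
  (derive1 (fun t : R => complex.Im (f (z + t%:C * v))) 0).

Definition plane_dz f z : R[i]^o :=
  (dir_deriv 1 f z - 'i%C * dir_deriv 'i%C f z) / 2.

Definition plane_dzbar f z : R[i]^o :=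
  (dir_deriv 1 f z + 'i%C * dir_deriv 'i%C f z) / 2.

(* f is of class C^k in the real sense on the open set U. *)
Fixpoint class_C (k : nat) U f : Prop :=
  (forall z, U z -> {for z, continuous f}) /\
  if k is k'.+1 then
    [/\ forall z, U z -> dir_derivable 1 f z /\ dir_derivable 'i%C f z,
        class_C k' U (dir_deriv 1 f) & class_C k' U (dir_deriv 'i%C f)]
  else True.

End PlaneCalculus.

Section Bundles.
Context {R : realType} {M : riemann_surface R} {n : nat}.

Section SurfaceCalculus.
Context {p q : nat}.
Implicit Types (F : M -> 'M[R[i]]_(p, q)) (c : chart M) (x : M).

Definition smooth_on c F : Prop := forall k i j,
  class_C k (cmap c @` cdom c) (fun z => F (cinv c z) i j).

Definition smooth F : Prop := forall c, smooth_on c F.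

(* d/dz and d/dzbar in the coordinate of the chart c, entry by entry. *)
Definition dz c F x : 'M[R[i]]_(p, q) :=
  \matrix_(i, j) plane_dz (fun z => F (cinv c z) i j) (cmap c x).

Definition dzbar c F x : 'M[R[i]]_(p, q) :=
  \matrix_(i, j) plane_dzbar (fun z => F (cinv c z) i j) (cmap c x).

End SurfaceCalculus.

(* A subbundle psi of M x C^n is given by the field of its orthogonal
   projections pi_psi, vectors of C^n being columns. *)
Local Notation mxfield := (M -> 'M[R[i]]_n).

(* The rank of a subbundle is the locally constant trace of its projection. *)
Definition subbundle (psi : mxfield) : Prop :=
  smooth psi /\ forall x, (psi x)^t* = psi x /\ psi x *m psi x = psi x.

Definition fibre (psi : mxfield) x (v : 'cV[R[i]]_n) : Prop := psi x *m v = v.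

Definition perp (psi : mxfield) : mxfield := fun x => 1%:M - psi x.

Definition bsub (psi chi : mxfield) : Prop :=
  forall x v, fibre psi x v -> fibre chi x v.

Definition orthogonal (psi chi : mxfield) : Prop :=
  forall x v w, fibre psi x v -> fibre chi x w -> v^t* *m w = 0.

Definition section_on (c : chart M) (psi : mxfield) (s : M -> 'cV[R[i]]_n) : Prop :=
  smooth_on c s /\ forall x, cdom c x -> fibre psi x (s x).

Definition closed_under (psi : mxfield)
    (D : chart M -> (M -> 'cV[R[i]]_n) -> (M -> 'cV[R[i]]_n)) : Prop :=
  forall c s, section_on c psi s -> section_on c psi (D c s).

Definition grassmann_map (k : nat) (phi : mxfield) : Prop :=
  subbundle phi /\ forall x, \rank (phi x) = k.

(* Vanishing of the tension field.  G_k(C^n) is isometrically embedded in the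
   Hermitian matrices by phi |-> pi_phi, with tangent space at P the Hermitian X
   such that P X + X P = X; the tension field is the tangential part
   P X P^perp + P^perp X P of X = 4 d_zbar d_z P (up to the conformal factor). *)
Definition harmonic_grassmann (phi : mxfield) : Prop :=
  forall c x, cdom c x ->
    let L := dzbar c (dz c phi) x in
    phi x *m L *m perp phi x + perp phi x *m L *m phi x = 0.

Definition holomorphic_subbundle (phi alpha : mxfield) : Prop :=
  [/\ subbundle alpha, bsub alpha phi
    & closed_under alpha (fun c s x => phi x *m dzbar c s x)].

Definition conn_z (c : chart M) (Phi : mxfield) : mxfield :=
  fun x => 2^-1 *: (invmx (Phi x) *m dz c Phi x).

Definition conn_zbar (c : chart M) (Phi : mxfield) : mxfield :=
  fun x => 2^-1 *: (invmx (Phi x) *m dzbar c Phi x).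

(* The harmonic map equation d^* (Phi^-1 d Phi) = 0 for maps M -> U(n). *)
Definition harmonic_unitary (Phi : mxfield) : Prop :=
  [/\ smooth Phi, forall x, Phi x \is unitarymx
    & forall c x, cdom c x ->
        dzbar c (conn_z c Phi) x + dz c (conn_zbar c Phi) x = 0].

Definition uniton (Phi alpha : mxfield) : Prop :=
  [/\ harmonic_unitary Phi, subbundle alpha,
      closed_under alpha (fun c s x => dzbar c s x + conn_zbar c Phi x *m s x)
    & closed_under alpha (fun c s x => conn_z c Phi x *m s x)].

Definition cartan (alpha : mxfield) : mxfield := fun x => alpha x - perp alpha x.

Definition uniton_product (Q : 'M[R[i]]_n) (alpha : nat -> mxfield) (s : nat) : mxfield :=
  fun x => Q * \prod_(i < s) cartan (alpha i) x.

Definition finite_uniton_number (Phi : mxfield) : Prop :=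
  exists Q s (alpha : nat -> mxfield),
    [/\ Q \is unitarymx,
        forall i, (i < s)%N -> uniton (uniton_product Q alpha i) (alpha i)
      & forall x, Phi x = uniton_product Q alpha s x].

(* Bundle maps defined with the help of d/dz depend on the chart; only the
   values over cdom c matter. *)
Local Notation bundle_map := (chart M -> M -> 'M[R[i]]_n).

(* A'_{psi,chi} for chi orthogonal to psi: since a section s of psi satisfies
   s = pi_psi s, one has
   pi_chi (d_z s) = pi_chi (d_z pi_psi) s + pi_chi pi_psi (d_z s)
                  = pi_chi (d_z pi_psi) s.
   The last factor extends the map by 0 on the complement of psi. *)
Definition second_ff (psi chi : mxfield) : bundle_map :=
  fun c x => chi x *m dz c psi x *m psi x.

Definition bpow (T : bundle_map) (q : nat) : bundle_map :=
  fun c x => T c x ^+ q.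

Definition zero_on (psi : mxfield) (T : bundle_map) : Prop :=
  forall c x v, cdom c x -> fibre psi x v -> T c x *m v = 0.

(* Q is the image (resp. kernel) of T on psi, extended to a subbundle over a set
   of isolated points.  Such an extension is unique, by continuity. *)
Definition filled_image (psi : mxfield) (T : bundle_map) (Q : mxfield) : Prop :=
  subbundle Q /\ forall x0, \forall x \near x0^', forall c, cdom c x ->
    forall w, fibre Q x w <-> exists2 v, fibre psi x v & w = T c x *m v.

Definition filled_kernel (psi : mxfield) (T : bundle_map) (Q : mxfield) : Prop :=
  subbundle Q /\ forall x0, \forall x \near x0^', forall c, cdom c x ->
    forall v, fibre Q x v <-> fibre psi x v /\ T c x *m v = 0.

Definition gauss_bundles (phi : mxfield) (G : nat -> mxfield) : Prop :=
  (forall x, G 0%N x = phi x) /\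
  forall i, filled_image (G i) (second_ff (G i) (perp (G i))) (G i.+1).

Definition isotropic_upto (phi : mxfield) (G : nat -> mxfield) (r : nat) : Prop :=
  forall i, (1 <= i <= r)%N -> orthogonal phi (G i).

Definition isotropy_order (phi : mxfield) (G : nat -> mxfield) (r : nat) : Prop :=
  [/\ (1 <= r)%N, isotropic_upto phi G r
    & forall r', isotropic_upto phi G r' -> (r' <= r)%N].

(* The summands G 0, ..., G r are mutually orthogonal when r is the isotropy
   order, so the projection onto their sum is the sum of the projections. *)
Definition remainder (G : nat -> mxfield) (r : nat) : mxfield :=
  perp (fun x => \sum_(i < r.+1) G i x).

(* A'_{G i.-1} o ... o A'_{G 1} o A'_{G 0}, on G 0. *)
Fixpoint gauss_chain (G : nat -> mxfield) (i : nat) : bundle_map :=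
  fun c x =>
    if i is i'.+1 then
      second_ff (G i') (perp (G i')) c x *m gauss_chain G i' c x
    else G 0%N x.

Definition first_return (phi : mxfield) (G : nat -> mxfield) (r : nat) : bundle_map :=
  fun c x => second_ff (G r) phi c x *m gauss_chain G r c x.

Definition second_return (phi : mxfield) (G : nat -> mxfield) (r : nat) : bundle_map :=
  fun c x => second_ff (remainder G r) phi c x
    *m second_ff (G r) (remainder G r) c x *m gauss_chain G r c x.

Definition nilorder (psi : mxfield) (T : bundle_map) (p : nat) : Prop :=
  zero_on psi (bpow T p) /\
  forall q, zero_on psi (bpow T q) -> (p <= q)%N.

Definition nilpotent_on (psi : mxfield) (T : bundle_map) : Prop :=
  exists N, zero_on psi (bpow T N).

End Bundles.

(* Main.v *)
Require Import Defs.
From mathcomp Require Import all_boot all_order all_algebra.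
From mathcomp Require Import all_classical all_reals all_analysis.
From mathcomp Require Import complex.
From mathcomp Require Import ring lra zify.

Set Implicit Arguments.
Unset Strict Implicit.
Unset Printing Implicit Defensive.

Import Order.TTheory GRing.Theory Num.Theory.
Import numFieldNormedType.Exports.

Local Open Scope classical_set_scope.
Local Open Scope ring_scope.
Local Open Scope complex_scope.
Local Open Scope sesquilinear_scope.

(** The pencil of operators [D_mu = d_z + (1 - mu) A], with [A] half the
    logarithmic derivative of [pi_phi - pi_phi^perp], is gauge equivalent to
    [d_z] through a product of factors [pi + mu pi^perp], one for each uniton;
    hence the powers [D_mu ^ N] have degree in [mu] bounded independently of [N].
    Conjugating by [phi + mu phi^perp] and decomposing C^n into
    [G 0, ..., G r] and the remainder, [D_mu] becomes [d_z] with the components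
    [G r -> phi] and [remainder -> phi] multiplied by [mu ^ 2]; all other
    off-diagonal components are [G i -> G i.+1] and [G r -> remainder].  The
    coefficients of [D_mu ^ N] are therefore sums over cyclic paths, a turn
    through [c] costing r + 1 derivatives and a turn through [e] costing r + 2.
    Since [c ^ p = 0] and even [c ^ p.-1] kills the component [G r -> phi], the
    only path from [ker c] to [phi] making [t * p] turns with [t] extra
    derivatives is [(c ^ p.-1 e) ^ t], which must vanish for large [t]. *)


(** * Calculus in the plane *)

(** The field [A] is minus the sum of the two blocks of [d_z] that are off-diagonal for [phi], so
    [D_mu] is [d_z] with these blocks multiplied by [mu]. A gauge factor [P + mu (1 - P)] has
    inverse [mu P + (1 - P)] divided by [mu]: one conjugation raises degrees by at most one,
    whatever the power of the operator, and [s] unitons give the bound [s]. The scarcity of arrows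
    comes from harmonicity: the zbar-derivative of a section of a Gauss bundle returns to the
    preceding bundle, and the adjoint statement is that [d_z] enters [G i.+1] only from [G i].
    Isotropy supplies the orthogonality. The obstacle is that powers of [D_mu] are differential
    operators, so most coefficients contain derivatives of the chosen section. A differentiation
    inside a summand and a detour through the remainder both cost one step. After a differentiation,
    however, the turn closes through the component [G r -> phi], which [c ^ p.-1] kills; so at the
    extremal index only the detours survive and the coefficient is purely algebraic. That index
    grows with [t] while the degree bound stays fixed; [t = s + 1] is already too large. *)

Section PlaneCalculus.
Context {R : realType}.
Implicit Types (f g : R[i]^o -> R[i]^o) (v w z d e : R[i]^o) (U : set R[i]^o).

(** Existence and value of the derivative are kept together, since [dir_deriv] alone also has a
    value where no derivative exists. *)
Definition is_dir v f z d :=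
  is_derive (0 : R) 1 (fun t : R => complex.Re (f (z + t%:C * v))) (complex.Re d) /\
  is_derive (0 : R) 1 (fun t : R => complex.Im (f (z + t%:C * v))) (complex.Im d).

Lemma is_dirP v f z : dir_derivable v f z <-> is_dir v f z (dir_deriv v f z).
Proof.
split=> [[hr hi]|[hr hi]].
  split; rewrite /dir_deriv /=.
    by rewrite derive1E; exact: (derivableP hr).
  by rewrite derive1E; exact: (derivableP hi).
by split; [exact: (@ex_derive _ _ _ _ _ _ _ hr)|exact: (@ex_derive _ _ _ _ _ _ _ hi)].
Qed.

Lemma is_dir_derivable v f z d : is_dir v f z d -> dir_derivable v f z.
Proof. by move=> [hr hi]; split; [exact: (@ex_derive _ _ _ _ _ _ _ hr)|exact: (@ex_derive _ _ _ _ _ _ _ hi)]. Qed.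

Lemma is_dir_val v f z d : is_dir v f z d -> dir_deriv v f z = d.
Proof.
by case: d => a b [hr hi]; rewrite /dir_deriv !derive1E (@derive_val _ _ _ _ _ _ _ hr)
  (@derive_val _ _ _ _ _ _ _ hi).
Qed.

Lemma is_dir_cst v c z : is_dir v (fun=> c) z 0.
Proof. by split; apply: is_derive_cst. Qed.


Let is_derive_ext (F G : R -> R) (a b : R) :
  is_derive (0 : R) 1 F a -> F =1 G -> a = b -> is_derive (0 : R) 1 G b.
Proof. by move=> dF /funext <- <-. Qed.

Lemma is_dirD v f g z d e : is_dir v f z d -> is_dir v g z e ->
  is_dir v (fun x => f x + g x) z (d + e).
Proof.
move=> [fr fi] [gr gi]; split.
  by apply: is_derive_ext (is_deriveD fr gr) _ _ => [t|]; rewrite raddfD.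
by apply: is_derive_ext (is_deriveD fi gi) _ _ => [t|]; rewrite raddfD.
Qed.

Lemma is_dirM v f g z d e : is_dir v f z d -> is_dir v g z e ->
  is_dir v (fun x => f x * g x) z (d * g z + f z * e).
Proof.
move=> [fr fi] [gr gi].
have zE : z + 0%:C * v = z by rewrite rmorph0 mul0r addr0.
split.
  apply: is_derive_ext (is_deriveB (is_deriveM fr gr) (is_deriveM fi gi)) _ _.
    by move=> t; rewrite !fctE; case: (f _) (g _) => [a b] [a1 b1].
  rewrite zE; move: (d) (e) (f z) (g z) => [a b] [a1 b1] [a2 b2] [a3 b3].
  by rewrite /GRing.scale /=; ring.
apply: is_derive_ext (is_deriveD (is_deriveM fr gi) (is_deriveM fi gr)) _ _.
  by move=> t; rewrite !fctE; case: (f _) (g _) => [a b] [a1 b1].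
rewrite zE; move: (d) (e) (f z) (g z) => [a b] [a1 b1] [a2 b2] [a3 b3].
  by rewrite /GRing.scale /=; ring.
Qed.

Lemma is_dir_conj v f z d : is_dir v f z d ->
  is_dir v (fun x => conjc (f x)) z (conjc d).
Proof.
move=> [fr fi]; split.
  by apply: is_derive_ext fr _ _ => [t|] /=; [case: (f _) => a b | case: (d) => a b].
by apply: is_derive_ext (is_deriveN fi) _ _ => [t|]; rewrite ?fctE /=;
  [case: (f _) => a b | case: (d) => a b].
Qed.

Lemma line_near v z U : open U -> U z -> \forall t \near (0 : R), U (z + t%:C * v).
Proof.
move=> oU Uz.
have /nbhs_ballP[e e0 eU] : nbhs z U by apply: open_nbhs_nbhs.
(* A positive element of [R[i]] is real, so the radius of the ball may be replaced by its real
   part. *)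
have e0' : 0 < complex.Re e by move: e0; rewrite /= ltcE => /andP[].
have eE : e = (complex.Re e)%:C.
  by move: e0; rewrite /= ltcE /= => /andP[/eqP + _]; case: (e) => a b /= ->.
have [v0|v0] := eqVneq v 0.
  by near=> t; rewrite v0 mulr0 addr0.
pose s : R := Num.sqrt (complex.Re v ^+ 2 + complex.Im v ^+ 2).
have s0 : 0 < s by rewrite -ltcR -normc_def rmorph0 normr_gt0.
apply/nbhs_ballP; exists (complex.Re e / s); first by rewrite /= divr_gt0.
move=> t; rewrite /ball /= sub0r normrN ltr_pdivlMr // => ts.
apply: eU; rewrite -ball_normE /= opprD addNKr normrN normrM normc_def /=.
by rewrite expr0n addr0 sqrtr_sqr eE (normc_def v) -rmorphM ltcR.
Unshelve. all: by end_near. Qed.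

Lemma is_dir_ext v f g z d U : open U -> U z -> (forall x, U x -> f x = g x) ->
  is_dir v f z d -> is_dir v g z d.
Proof.
move=> oU Uz fg [fr fi]; have nU := line_near v oU Uz.
by split; [apply: near_eq_is_derive fr|apply: near_eq_is_derive fi];
  near=> t; rewrite fg //; near: t.
Unshelve. all: by end_near. Qed.

Lemma dir_deriv_ext v f g z U : open U -> U z -> (forall x, U x -> f x = g x) ->
  dir_deriv v f z = dir_deriv v g z.
Proof.
move=> oU Uz fg; have nU := line_near v oU Uz.
rewrite /dir_deriv !derive1E; congr (_ +i* _); apply: near_eq_derive;
  by near=> t; rewrite fg //; near: t.
Unshelve. all: by end_near. Qed.

Lemma continuous_ext f g z U : open U -> U z -> (forall x, U x -> f x = g x) ->
  {for z, continuous f} -> {for z, continuous g}.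
Proof.
move=> oU Uz fg cf; suff: g @ z --> f z by rewrite fg.
have nU : nbhs z U by apply: open_nbhs_nbhs.
have E : {near nbhs z, f =1 g} by apply: filterS nU => x; exact: fg.
exact: cvg_trans (near_eq_cvg E) cf.
Qed.

Lemma continuous_distP f z : {for z, continuous f} <->
  forall eps : R[i], 0 < eps -> \forall x \near nbhs z, `|f z - f x| < eps.
Proof. exact: (@cvgrPdist_lt _ _ _ (nbhs z) _ f (f z)). Qed.

Lemma continuous_conj f z : {for z, continuous f} ->
  {for z, continuous (fun x => (conjc (f x) : R[i]^o))}.
Proof.
move=> /continuous_distP cf; apply/continuous_distP => eps e0.
by apply: filterS (cf _ e0) => x; rewrite -rmorphB normcJ.
Qed.

Lemma class_C_ext k U f g : open U -> (forall x, U x -> f x = g x) ->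
  class_C k U f -> class_C k U g.
Proof.
move=> oU; elim: k f g => [|k IH] f g fg /= [cf].
  by move=> _; split; [move=> z Uz; exact: (continuous_ext oU Uz fg (cf z Uz))|].
move=> [df d1 d2]; split.
  by move=> z Uz; exact: (continuous_ext oU Uz fg (cf z Uz)).
have E v x : U x -> dir_deriv v f x = dir_deriv v g x.
  by move=> Ux; exact: (dir_deriv_ext _ oU Ux fg).
split; [move=> z Uz | exact: IH (E _) d1 | exact: IH (E _) d2].
by case: (df z Uz) => /is_dirP h1 /is_dirP h2; split;
  apply: is_dir_derivable; apply: (is_dir_ext oU Uz fg); eauto.
Qed.

Lemma class_CS k U f : class_C k.+1 U f -> class_C k U f.
Proof.
elim: k f => [|k IH] f [cf].
  by move=> _; split; [exact: cf|].
move=> [df d1 d2]; split; first exact: cf.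
by split; [exact: df|exact: (IH _ d1)|exact: (IH _ d2)].
Qed.

Lemma class_C_cst k U (c : R[i]^o) : open U -> class_C k U (fun=> c).
Proof.
move=> oU; elim: k c => [|k IH] c.
  by split; [move=> z _; exact: cst_continuous|].
split; first by move=> z _; exact: cst_continuous.
split.
- by move=> z _; split; exact: (is_dir_derivable (is_dir_cst _ _ _)).
- by apply: (class_C_ext oU _ (IH 0)) => x _; rewrite (is_dir_val (is_dir_cst _ _ _)).
- by apply: (class_C_ext oU _ (IH 0)) => x _; rewrite (is_dir_val (is_dir_cst _ _ _)).
Qed.

Lemma class_CD k U f g : open U -> class_C k U f -> class_C k U g ->
  class_C k U (fun x => f x + g x).
Proof.
move=> oU; elim: k f g => [|k IH] f g [cf hf] [cg hg].
  by split; [move=> z Uz; apply: continuousD; [exact: cf | exact: cg]|].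
split; first by move=> z Uz; apply: continuousD; [exact: cf | exact: cg].
have [df f1 f2] := hf; have [dg g1 g2] := hg.
split.
- move=> z Uz; case: (df z Uz) => /is_dirP h1 /is_dirP h2.
  case: (dg z Uz) => /is_dirP k1 /is_dirP k2.
  by split; [exact: (is_dir_derivable (is_dirD h1 k1))|
    exact: (is_dir_derivable (is_dirD h2 k2))].
- apply: (class_C_ext oU _ (IH _ _ f1 g1)) => z Uz.
  case: (df z Uz) => /is_dirP h1 _; case: (dg z Uz) => /is_dirP k1 _.
  by rewrite (is_dir_val (is_dirD h1 k1)).
- apply: (class_C_ext oU _ (IH _ _ f2 g2)) => z Uz.
  case: (df z Uz) => _ /is_dirP h1; case: (dg z Uz) => _ /is_dirP k1.
  by rewrite (is_dir_val (is_dirD h1 k1)).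
Qed.

Lemma class_CM k U f g : open U -> class_C k U f -> class_C k U g ->
  class_C k U (fun x => f x * g x).
Proof.
move=> oU; elim: k f g => [|k IH] f g hf0 hg0.
  case: hf0 hg0 => [cf _] [cg _]; split; last by [].
  by move=> z Uz; apply: (@continuousM R[i]); [exact: cf | exact: cg].
have [cf [df f1 f2]] := hf0; have [cg [dg g1 g2]] := hg0.
(* In the Leibniz rule a derivative of class [k] meets an undifferentiated factor, whose class is
   lowered to [k]. *)
have fk := class_CS hf0; have gk := class_CS hg0.
split; first by move=> z Uz; apply: (@continuousM R[i]); [exact: cf | exact: cg].
split.
- move=> z Uz; case: (df z Uz) => /is_dirP h1 /is_dirP h2.
  case: (dg z Uz) => /is_dirP k1 /is_dirP k2.
  by split; [exact: (is_dir_derivable (is_dirM h1 k1))|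
    exact: (is_dir_derivable (is_dirM h2 k2))].
- apply: (class_C_ext oU _ (class_CD oU (IH _ _ f1 gk) (IH _ _ fk g1))) => z Uz.
  case: (df z Uz) => /is_dirP h1 _; case: (dg z Uz) => /is_dirP k1 _.
  by rewrite (is_dir_val (is_dirM h1 k1)).
- apply: (class_C_ext oU _ (class_CD oU (IH _ _ f2 gk) (IH _ _ fk g2))) => z Uz.
  case: (df z Uz) => _ /is_dirP h1; case: (dg z Uz) => _ /is_dirP k1.
  by rewrite (is_dir_val (is_dirM h1 k1)).
Qed.

Lemma class_C_conj k U f : open U -> class_C k U f ->
  class_C k U (fun x => conjc (f x)).
Proof.
move=> oU; elim: k f => [|k IH] f [cf hf].
  by split; [move=> z Uz; apply: continuous_conj; exact: cf|].
split; first by move=> z Uz; apply: continuous_conj; exact: cf.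
have [df f1 f2] := hf.
split.
- move=> z Uz; case: (df z Uz) => /is_dirP h1 /is_dirP h2.
  by split; [exact: (is_dir_derivable (is_dir_conj h1))|
    exact: (is_dir_derivable (is_dir_conj h2))].
- apply: (class_C_ext oU _ (IH _ f1)) => z Uz.
  by case: (df z Uz) => /is_dirP h1 _; rewrite (is_dir_val (is_dir_conj h1)).
- apply: (class_C_ext oU _ (IH _ f2)) => z Uz.
  by case: (df z Uz) => _ /is_dirP h1; rewrite (is_dir_val (is_dir_conj h1)).
Qed.

End PlaneCalculus.

(** * Symmetry of second derivatives *)

Section MixedPartials.
Context {R : realType}.

(** The second difference over the square of side [h] is a first difference in [s] of a difference
    in [t]; the mean value theorem is applied once in each variable. *)
Lemma mixed_mean_value (F F1 F12 : R -> R -> R) (d h : R) : 0 < h -> h < d ->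
  (forall s t : R, `|s| < d -> `|t| < d -> is_derive s 1 (F^~ t) (F1 s t)) ->
  (forall s t : R, `|s| < d -> `|t| < d -> is_derive t 1 (F1 s) (F12 s t)) ->
  exists s t, [/\ 0 < s < h, 0 < t < h &
    F h h - F 0 h - F h 0 + F 0 0 = F12 s t * h * h].
Proof.
move=> h0 hd dF dF1.
have small x : x \in `[0, h]%R -> `|x| < d.
  by rewrite in_itv /= => /andP[x0 xh]; rewrite ger0_norm //; apply: le_lt_trans hd.
have small' x : x \in `]0, h[%R -> `|x| < d.
  by move=> /subset_itv_oo_cc /small.
have sh : `|h| < d by apply: small; rewrite in_itv /= lexx ltW.
have s0 : `|0 : R| < d by apply: small; rewrite in_itv /= lexx ltW.
pose g s := F s h - F s 0.
have dg (s : R) : `|s| < d -> is_derive s 1 g (F1 s h - F1 s 0).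
  by move=> sd; apply: is_deriveB; apply: dF.
have [||s si Es] := @MVT R g (fun s => F1 s h - F1 s 0) 0 h h0.
- by move=> x /small' /dg.
- by apply: derivable_within_continuous => x /small /dg [].
have sd := small' _ si.
have [||t ti Et] := @MVT R (F1 s) (F12 s) 0 h h0.
- by move=> x /small'; apply: dF1.
- by apply: derivable_within_continuous => x /small xd; case: (dF1 s x sd xd).
exists s, t; split; [by move: si; rewrite in_itv| by move: ti; rewrite in_itv|].
by move: Es Et; rewrite /g !subr0 => Es Et; rewrite -Et -Es; ring.
Qed.

(** The second difference is symmetric in the two variables. Computed in both orders, it makes the
    two mixed derivatives agree at a pair of points arbitrarily close to the origin, and continuity
    there concludes. *)
Lemma mixed_partials_real (F F1 F2 F12 F21 : R -> R -> R) (d : R) : 0 < d ->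
  (forall s t : R, `|s| < d -> `|t| < d -> is_derive s 1 (F^~ t) (F1 s t)) ->
  (forall s t : R, `|s| < d -> `|t| < d -> is_derive t 1 (F s) (F2 s t)) ->
  (forall s t : R, `|s| < d -> `|t| < d -> is_derive t 1 (F1 s) (F12 s t)) ->
  (forall s t : R, `|s| < d -> `|t| < d -> is_derive s 1 (F2^~ t) (F21 s t)) ->
  (forall e, 0 < e -> exists2 d', 0 < d' &
    forall s t, `|s| < d' -> `|t| < d' -> `|F12 0 0 - F12 s t| < e) ->
  (forall e, 0 < e -> exists2 d', 0 < d' &
    forall s t, `|s| < d' -> `|t| < d' -> `|F21 0 0 - F21 s t| < e) ->
  F12 0 0 = F21 0 0.
Proof.
move=> d0 dF1 dF2 dF12 dF21 c12 c21.
apply/eqP; rewrite -subr_eq0 -normr_le0; apply/ler_addgt0Pl => e e0; rewrite addr0.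
have e2 : 0 < e / 2 by rewrite divr_gt0.
have [d1 d10 h1] := c12 _ e2; have [d2 d20 h2] := c21 _ e2.
pose m := Num.min d (Num.min d1 d2).
have m0 : 0 < m by rewrite !lt_min d0 d10 d20.
pose h := m / 2.
have h0 : 0 < h by rewrite divr_gt0.
have hm : h < m by rewrite /h; lra.
have [md m1 m2] : [/\ h < d, h < d1 & h < d2].
  by move: hm; rewrite !lt_min => /and3P[].
have [s [t [/andP[s0 sh] /andP[t0 th] E1]]] := mixed_mean_value h0 md dF1 dF12.
have [t' [s' [/andP[t0' th'] /andP[s0' sh'] E2]]] :=
  @mixed_mean_value (fun t s => F s t) (fun t s => F2 s t) (fun t s => F21 s t) d h h0 md
    (fun t s td sd => dF2 s t sd td) (fun t s td sd => dF21 s t sd td).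
have E : F12 s t = F21 s' t'.
  apply: (mulIf (lt0r_neq0 h0)); apply: (mulIf (lt0r_neq0 h0)).
  by rewrite -E1 -E2; ring.
have lt x y : 0 < x -> x < h -> h < y -> `|x| < y.
  by move=> x0 xh hy; rewrite gtr0_norm //; apply: lt_trans hy.
have := h1 s t (lt _ _ s0 sh m1) (lt _ _ t0 th m1).
have := h2 s' t' (lt _ _ s0' sh' m2) (lt _ _ t0' th' m2).
rewrite E => /ltW a /ltW b.
have -> : F12 0 0 - F21 0 0 = (F12 0 0 - F21 s' t') - (F21 0 0 - F21 s' t') by ring.
apply: le_trans (ler_normB _ _) _; move: a b.
  by set x := `|_|; set y := `|_|; move=> ? ?; lra.
Qed.

Implicit Types (f g : R[i]^o -> R[i]^o) (v w z : R[i]^o) (U : set R[i]^o).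

Let comp (b : bool) : R[i]^o -> R := if b then @complex.Re R else @complex.Im R.

Let comp_le b (x : R[i]^o) : (`|comp b x|)%:C <= `|x|.
Proof.
case: b => /=; rewrite normc_def lecR -sqrtr_sqr ler_wsqrtr //.
  by rewrite lerDl sqr_ge0.
by rewrite lerDr sqr_ge0.
Qed.

Let compB b (x y : R[i]^o) : comp b (x - y) = comp b x - comp b y.
Proof. by case: b => /=; rewrite raddfB. Qed.

Let is_dir_comp b v f z d : is_dir v f z d ->
  is_derive (0 : R) 1 (fun t : R => comp b (f (z + t%:C * v))) (comp b d).
Proof. by case: b => -[]. Qed.

Let is_dir_at b v f z d (s : R) : is_dir v f (z + s%:C * v) d ->
  is_derive s 1 (fun t : R => comp b (f (z + t%:C * v))) (comp b d).
Proof.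
move=> /(is_dir_comp b) h.
have k : is_derive s 1 (fun t : R => t - s) (1 - 0).
  exact: is_deriveB.
have h' : is_derive (s - s) 1 (fun t : R => comp b (f (z + s%:C * v + t%:C * v))) (comp b d).
  by rewrite subrr.
have := @is_derive1_comp R (fun t : R => comp b (f (z + s%:C * v + t%:C * v)))
    (fun t => t - s) s _ _ h' k; rewrite subr0 mulr1.
congr is_derive; apply/funext => t /=; congr (comp b (f _)).
by rewrite -addrA -mulrDl -rmorphD [s + _]addrC subrK.
Qed.

Let near_square z v w (P : set R[i]^o) : nbhs z P -> exists2 d : R, 0 < d &
  forall s t : R, `|s| < d -> `|t| < d -> P (z + s%:C * v + t%:C * w).
Proof.
move=> /nbhs_ballP[e e0 eU].
have e0' : 0 < complex.Re e by move: e0; rewrite /= ltcE => /andP[].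
have eE : e = (complex.Re e)%:C.
  by move: e0; rewrite /= ltcE /= => /andP[/eqP + _]; case: (e) => a b /= ->.
pose nv : R := Num.sqrt (complex.Re v ^+ 2 + complex.Im v ^+ 2).
pose nw : R := Num.sqrt (complex.Re w ^+ 2 + complex.Im w ^+ 2).
have nv0 : 0 <= nv by apply: sqrtr_ge0.
have nw0 : 0 <= nw by apply: sqrtr_ge0.
(* The added 1 keeps the denominator positive when both directions vanish. *)
have k0 : 0 < nv + nw + 1 by lra.
exists (complex.Re e / (nv + nw + 1)); first by rewrite divr_gt0.
move=> s t; rewrite !ltr_pdivlMr // => hs ht; apply: eU.
rewrite -ball_normE /= -addrA opprD addNKr normrN eE.
apply: le_lt_trans (ler_normD _ _) _; rewrite !normrM !(normc_def s%:C) !(normc_def t%:C) /=.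
rewrite !expr0n !addr0 !sqrtr_sqr (normc_def v) (normc_def w) -!rmorphM -rmorphD ltcR -/nv -/nw.
set m := Num.max `|s| `|t|.
have sm : `|s| <= m by rewrite le_max lexx.
have tm : `|t| <= m by rewrite le_max lexx orbT.
have m0 : 0 <= m by apply: le_trans sm.
have hm : m * (nv + nw + 1) < complex.Re e by rewrite /m; case: (leP `|s| `|t|).
have a1 : `|s| * nv <= m * nv by rewrite ler_wpM2r.
have a2 : `|t| * nw <= m * nw by rewrite ler_wpM2r.
have [m0'|m0'] := eqVneq m 0.
  by apply: le_lt_trans (lerD a1 a2) _; rewrite m0' !mul0r addr0.
have {}m0 : 0 < m by rewrite lt_neqAle eq_sym m0' m0.
by apply: le_lt_trans (lerD a1 a2) _; nra.
Qed.

Lemma dir_deriv_comm U f z v w : open U -> U z ->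
  (forall x, U x -> [/\ dir_derivable v f x, dir_derivable w f x,
    dir_derivable w (dir_deriv v f) x & dir_derivable v (dir_deriv w f) x]) ->
  {for z, continuous (dir_deriv w (dir_deriv v f))} ->
  {for z, continuous (dir_deriv v (dir_deriv w f))} ->
  dir_deriv w (dir_deriv v f) z = dir_deriv v (dir_deriv w f) z.
Proof.
move=> oU Uz dU c1 c2.
have [d d0 dP] := near_square v w (open_nbhs_nbhs (conj oU Uz)).
have zE : z + 0%:C * v + 0%:C * w = z by rewrite !rmorph0 !mul0r !addr0.
have comm (s t : R) : z + s%:C * v + t%:C * w = z + t%:C * w + s%:C * v.
  by rewrite addrAC.
have cont b g : {for z, continuous g} -> forall e, 0 < e -> exists2 d', 0 < d' &
    forall s t, `|s| < d' -> `|t| < d' ->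
      `|comp b (g (z + 0%:C * v + 0%:C * w)) - comp b (g (z + s%:C * v + t%:C * w))| < e.
  move=> /continuous_distP cg e e0.
  have e0' : 0 < e%:C by rewrite ltcR.
  have [d' d0' dP'] := near_square v w (cg _ e0').
  exists d' => // s t sd td; rewrite zE -compB -ltcR.
  exact: le_lt_trans (comp_le _ _) (dP' _ _ sd td).
have H b : comp b (dir_deriv w (dir_deriv v f) z) = comp b (dir_deriv v (dir_deriv w f) z).
  rewrite -[in LHS]zE -[in RHS]zE.
  apply: (@mixed_partials_real (fun s t => comp b (f (z + s%:C * v + t%:C * w)))
    (fun s t => comp b (dir_deriv v f (z + s%:C * v + t%:C * w)))
    (fun s t => comp b (dir_deriv w f (z + s%:C * v + t%:C * w)))
    (fun s t => comp b (dir_deriv w (dir_deriv v f) (z + s%:C * v + t%:C * w)))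
    (fun s t => comp b (dir_deriv v (dir_deriv w f) (z + s%:C * v + t%:C * w))) d d0).
  - move=> s t sd td; have [/is_dirP h _ _ _] := dU _ (dP _ _ sd td).
    rewrite comm in h *; under eq_fun do rewrite comm; exact: is_dir_at h.
  - move=> s t sd td; have [_ /is_dirP h _ _] := dU _ (dP _ _ sd td).
    exact: is_dir_at h.
  - move=> s t sd td; have [_ _ /is_dirP h _] := dU _ (dP _ _ sd td).
    exact: is_dir_at h.
  - move=> s t sd td; have [_ _ _ /is_dirP h] := dU _ (dP _ _ sd td).
    rewrite comm in h *; under eq_fun do rewrite comm; exact: is_dir_at h.
  - exact: cont.
  - exact: cont.
have := H true; have := H false; rewrite /comp.
by case: (dir_deriv _ _ _) (dir_deriv _ _ _) => [a b] [a' b'] /= -> ->.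
Qed.

End MixedPartials.

(** * Smooth functions on an open set and their derivatives in z and zbar *)

Section SmoothFunctions.
Context {R : realType} (U : set R[i]^o).
Hypothesis openU : open U.
Implicit Types (f g : R[i]^o -> R[i]^o) (z : R[i]^o).

Definition smooth_fun f := forall k, class_C k U f.

Lemma smooth_fun_ext f g : (forall x, U x -> f x = g x) -> smooth_fun f -> smooth_fun g.
Proof. by move=> fg sf k; exact: (class_C_ext openU fg (sf k)). Qed.

Lemma smooth_fun_cst (a : R[i]^o) : smooth_fun (fun=> a).
Proof. by move=> k; exact: class_C_cst. Qed.

Lemma smooth_funD f g : smooth_fun f -> smooth_fun g ->
  smooth_fun (fun x => (f x : R[i]) + g x).
Proof. by move=> sf sg k; exact: (class_CD openU (sf k) (sg k)). Qed.

Lemma smooth_funM f g : smooth_fun f -> smooth_fun g ->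
  smooth_fun (fun x => (f x : R[i]) * g x).
Proof. by move=> sf sg k; exact: (class_CM openU (sf k) (sg k)). Qed.

Lemma smooth_fun_conj f : smooth_fun f -> smooth_fun (fun x => Num.conj (f x : R[i])).
Proof. by move=> sf k; exact: (class_C_conj openU (sf k)). Qed.

Lemma smooth_fun_is_dir f z : smooth_fun f -> U z ->
  is_dir 1 f z (dir_deriv 1 f z) /\ is_dir 'i%C f z (dir_deriv 'i%C f z).
Proof.
move=> sf Uz; have [_ [df _ _]] := sf 1%N.
by case: (df z Uz) => /is_dirP ? /is_dirP ?.
Qed.

Lemma smooth_fun_dir f : smooth_fun f ->
  smooth_fun (dir_deriv 1 f) /\ smooth_fun (dir_deriv 'i%C f).
Proof. by move=> sf; split=> k; have [_ [_ d1 d2]] := sf k.+1. Qed.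

Lemma smooth_fun_dz f : smooth_fun f -> smooth_fun (plane_dz f).
Proof.
move=> /smooth_fun_dir[d1 d2].
have h := smooth_funM (smooth_funD d1 (smooth_funM (smooth_fun_cst (- 'i%C)) d2))
  (smooth_fun_cst (2^-1)).
by apply: smooth_fun_ext h => x _; rewrite /plane_dz mulNr.
Qed.

Lemma smooth_fun_dzbar f : smooth_fun f -> smooth_fun (plane_dzbar f).
Proof.
move=> /smooth_fun_dir[d1 d2].
have h := smooth_funM (smooth_funD d1 (smooth_funM (smooth_fun_cst 'i%C) d2))
  (smooth_fun_cst (2^-1)).
by apply: smooth_fun_ext h => x _.
Qed.

Lemma plane_dz_ext f g z : U z -> (forall x, U x -> f x = g x) ->
  plane_dz f z = plane_dz g z.
Proof. by move=> Uz fg; rewrite /plane_dz !(dir_deriv_ext _ openU Uz fg). Qed.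

Lemma plane_dzbar_ext f g z : U z -> (forall x, U x -> f x = g x) ->
  plane_dzbar f z = plane_dzbar g z.
Proof. by move=> Uz fg; rewrite /plane_dzbar !(dir_deriv_ext _ openU Uz fg). Qed.

Let plane_dzE f z : plane_dz f z =
  ((dir_deriv 1 f z : R[i]) - 'i%C * (dir_deriv 'i%C f z : R[i])) / 2.
Proof. by []. Qed.

Let plane_dzbarE f z : plane_dzbar f z =
  ((dir_deriv 1 f z : R[i]) + 'i%C * (dir_deriv 'i%C f z : R[i])) / 2.
Proof. by []. Qed.

Let dir_derivD v f g z d e : is_dir v f z d -> is_dir v g z e ->
  dir_deriv v (fun x => (f x : R[i]) + g x) z = (d : R[i]) + e.
Proof. by move=> h k; exact: (is_dir_val (is_dirD h k)). Qed.

Let dir_derivM v f g z d e : is_dir v f z d -> is_dir v g z e ->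
  dir_deriv v (fun x => (f x : R[i]) * g x) z = (d : R[i]) * g z + (f z : R[i]) * e.
Proof. by move=> h k; exact: (is_dir_val (is_dirM h k)). Qed.

Let dir_deriv_conj v f z d : is_dir v f z d ->
  dir_deriv v (fun x => Num.conj (f x : R[i])) z = Num.conj (d : R[i]).
Proof. by move=> h; exact: (is_dir_val (is_dir_conj h)). Qed.

Let dir_deriv_cst v (a : R[i]^o) z : dir_deriv v (fun=> a) z = 0 :> R[i].
Proof. exact: (is_dir_val (is_dir_cst _ _ _)). Qed.

Lemma plane_dz_cst (a : R[i]^o) z : plane_dz (fun=> a) z = 0 :> R[i].
Proof. by rewrite plane_dzE !dir_deriv_cst mulr0 subrr mul0r. Qed.

Lemma plane_dzbar_cst (a : R[i]^o) z : plane_dzbar (fun=> a) z = 0 :> R[i].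
Proof. by rewrite plane_dzbarE !dir_deriv_cst mulr0 addr0 mul0r. Qed.

Section Rules.
Variables (f g : R[i]^o -> R[i]^o) (z : R[i]^o).
Hypotheses (sf : smooth_fun f) (sg : smooth_fun g) (Uz : U z).

Lemma plane_dzD : plane_dz (fun x => (f x : R[i]) + g x) z =
  (plane_dz f z : R[i]) + plane_dz g z.
Proof.
have [f1 f2] := smooth_fun_is_dir sf Uz; have [g1 g2] := smooth_fun_is_dir sg Uz.
by rewrite !plane_dzE (dir_derivD f1 g1) (dir_derivD f2 g2); ring.
Qed.

Lemma plane_dzbarD : plane_dzbar (fun x => (f x : R[i]) + g x) z =
  (plane_dzbar f z : R[i]) + plane_dzbar g z.
Proof.
have [f1 f2] := smooth_fun_is_dir sf Uz; have [g1 g2] := smooth_fun_is_dir sg Uz.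
by rewrite !plane_dzbarE (dir_derivD f1 g1) (dir_derivD f2 g2); ring.
Qed.

Lemma plane_dzM : plane_dz (fun x => (f x : R[i]) * g x) z =
  (plane_dz f z : R[i]) * g z + (f z : R[i]) * plane_dz g z.
Proof.
have [f1 f2] := smooth_fun_is_dir sf Uz; have [g1 g2] := smooth_fun_is_dir sg Uz.
by rewrite !plane_dzE (dir_derivM f1 g1) (dir_derivM f2 g2); ring.
Qed.

Lemma plane_dzbarM : plane_dzbar (fun x => (f x : R[i]) * g x) z =
  (plane_dzbar f z : R[i]) * g z + (f z : R[i]) * plane_dzbar g z.
Proof.
have [f1 f2] := smooth_fun_is_dir sf Uz; have [g1 g2] := smooth_fun_is_dir sg Uz.
by rewrite !plane_dzbarE (dir_derivM f1 g1) (dir_derivM f2 g2); ring.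
Qed.

Lemma plane_dz_conj : plane_dz (fun x => Num.conj (f x : R[i])) z =
  Num.conj (plane_dzbar f z : R[i]).
Proof.
have [f1 f2] := smooth_fun_is_dir sf Uz.
rewrite plane_dzE plane_dzbarE (dir_deriv_conj f1) (dir_deriv_conj f2).
have conjE (a b : R[i]) : Num.conj ((a + 'i%C * b) / 2) =
    (Num.conj a - 'i%C * Num.conj b) / 2.
  have c2 : Num.conj (2^-1 : R[i]) = 2^-1.
    by transitivity (conjc (2^-1 : R[i])) => //; rewrite conjc_inv conjc_nat.
  have ci : Num.conj ('i%C : R[i]) = - 'i%C.
    by transitivity (conjc ('i%C : R[i])) => //; simpc.
  have cM (x y : R[i]) : Num.conj (x * y) = Num.conj x * Num.conj y by exact: rmorphM.
  have cD (x y : R[i]) : Num.conj (x + y) = Num.conj x + Num.conj y by exact: rmorphD.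
  by rewrite cM c2 cD cM ci mulNr.
by rewrite conjE.
Qed.

(** Expanded in d/dx and d/dy, the two sides differ only in the order of the mixed derivative. *)
Lemma plane_dz_dzbar_comm :
  plane_dz (plane_dzbar f) z = plane_dzbar (plane_dz f) z.
Proof.
have [s1 s2] := smooth_fun_dir sf.
have [s11 s12] := smooth_fun_dir s1; have [s21 s22] := smooth_fun_dir s2.
have E : dir_deriv 'i%C (dir_deriv 1 f) z = dir_deriv 1 (dir_deriv 'i%C f) z.
  apply: (dir_deriv_comm openU Uz).
  - move=> x Ux.
    have [f1 f2] := smooth_fun_is_dir sf Ux.
    have [_ f12] := smooth_fun_is_dir s1 Ux; have [f21 _] := smooth_fun_is_dir s2 Ux.
    by split; apply: is_dir_derivable; [exact: f1|exact: f2|exact: f12|exact: f21].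
  - by case: (s12 0%N) => h _; exact: h.
  - by case: (s21 0%N) => h _; exact: h.
have [d11 d12] := smooth_fun_is_dir s1 Uz; have [d21 d22] := smooth_fun_is_dir s2 Uz.
have L v a : is_dir v (dir_deriv 1 f) z (dir_deriv v (dir_deriv 1 f) z) ->
    is_dir v (dir_deriv 'i%C f) z (dir_deriv v (dir_deriv 'i%C f) z) ->
    dir_deriv v (fun x => ((dir_deriv 1 f x : R[i]) + a * (dir_deriv 'i%C f x : R[i])) / 2) z =
    ((dir_deriv v (dir_deriv 1 f) z : R[i]) + a * (dir_deriv v (dir_deriv 'i%C f) z : R[i])) / 2.
  move=> h1 h2.
  have h := is_dirM (is_dirD h1 (is_dirM (is_dir_cst v (a : R[i]^o) z) h2)) (is_dir_cst v (2^-1 : R[i]^o) z).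
  by rewrite (is_dir_val h) !mul0r add0r mulr0 addr0.
have F1 : plane_dzbar f = fun x => ((dir_deriv 1 f x : R[i]) + 'i%C * (dir_deriv 'i%C f x : R[i])) / 2.
  by [].
have F2 : plane_dz f = fun x => ((dir_deriv 1 f x : R[i]) + (- 'i%C) * (dir_deriv 'i%C f x : R[i])) / 2.
  by apply/funext => x; rewrite plane_dzE mulNr.
rewrite plane_dzE plane_dzbarE F1 F2.
rewrite (L _ 'i%C d11 d21) (L _ 'i%C d12 d22) (L _ (- 'i%C) d11 d21) (L _ (- 'i%C) d12 d22) E.
have comm (a b d : R[i]) :
    ((a + 'i%C * b) / 2 - 'i%C * ((b + 'i%C * d) / 2)) / 2 =
    ((a + - 'i%C * b) / 2 + 'i%C * ((b + - 'i%C * d) / 2)) / 2 by ring.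
exact: comm.
Qed.

End Rules.

Lemma smooth_fun_sum (I : Type) (s : seq I) (F : I -> R[i]^o -> R[i]^o) :
  (forall i, smooth_fun (F i)) -> smooth_fun (fun x => \sum_(i <- s) (F i x : R[i])).
Proof.
move=> sF; elim: s => [|i s IH].
  by apply: smooth_fun_ext (smooth_fun_cst 0) => x _; rewrite big_nil.
by apply: smooth_fun_ext (smooth_funD (sF i) IH) => x _; rewrite big_cons.
Qed.

Lemma plane_dz_sum (I : Type) (s : seq I) (F : I -> R[i]^o -> R[i]^o) z :
  (forall i, smooth_fun (F i)) -> U z ->
  plane_dz (fun x => \sum_(i <- s) (F i x : R[i])) z =
  \sum_(i <- s) (plane_dz (F i) z : R[i]).
Proof.
move=> sF Uz; elim: s => [|i s IH].
  by under eq_fun do rewrite big_nil; rewrite plane_dz_cst big_nil.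
under eq_fun do rewrite big_cons.
by rewrite (plane_dzD (sF i) (smooth_fun_sum s sF) Uz) IH big_cons.
Qed.

Lemma plane_dzbar_sum (I : Type) (s : seq I) (F : I -> R[i]^o -> R[i]^o) z :
  (forall i, smooth_fun (F i)) -> U z ->
  plane_dzbar (fun x => \sum_(i <- s) (F i x : R[i])) z =
  \sum_(i <- s) (plane_dzbar (F i) z : R[i]).
Proof.
move=> sF Uz; elim: s => [|i s IH].
  by under eq_fun do rewrite big_nil; rewrite plane_dzbar_cst big_nil.
under eq_fun do rewrite big_cons.
by rewrite (plane_dzbarD (sF i) (smooth_fun_sum s sF) Uz) IH big_cons.
Qed.

Lemma smooth_fun_near0 f z : smooth_fun f -> U z ->
  (\forall x \near z^', f x = 0) -> f z = 0.
Proof.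
move=> sf Uz f0; apply: contrapT => /eqP fz.
have [cf _] := sf 0%N; move/continuous_distP: (cf z Uz) => c.
have n0 : 0 < `|f z : R[i]| by rewrite normr_gt0.
have /nbhs_dnbhs near1 := c _ n0.
have PF : ProperFilter z^' by exact: Proper_dnbhs_regular_numFieldType.
have [x [/= x1]] := filter_ex (filterI near1 f0).
by move=> x2; move: x1; rewrite x2 subr0 ltxx.
Qed.

End SmoothFunctions.

(** * Matrix-valued functions on the surface *)

Section MatrixFields.
Context {R : realType} {M : riemann_surface R} (c : chart M).

Local Notation U := (cmap c @` cdom c).

Let openU : open U := @cimg_open R M c.

Lemma chart_mem x : cdom c x -> U (cmap c x).
Proof. by move=> cx; exists x. Qed.

Lemma chartK z : U z -> cdom c (cinv c z) /\ cmap c (cinv c z) = z.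
Proof. by case=> x cx <-; rewrite cmapK. Qed.

Lemma smooth_onP p q (F : M -> 'M[R[i]]_(p, q)) : smooth_on c F <->
  forall i j, smooth_fun U (fun z => F (cinv c z) i j).
Proof. by split=> sF; [move=> i j k | move=> k i j]; exact: sF. Qed.

Section Basic.
Variables (p q : nat).
Implicit Types (F G : M -> 'M[R[i]]_(p, q)).

Lemma smooth_on_ext F G : (forall x, cdom c x -> F x = G x) ->
  smooth_on c F -> smooth_on c G.
Proof.
move=> FG /smooth_onP sF; apply/smooth_onP => i j.
by apply: (smooth_fun_ext openU _ (sF i j)) => z /chartK[cz _]; rewrite FG.
Qed.

Lemma smooth_on_cst (A : 'M[R[i]]_(p, q)) : smooth_on c (fun=> A).
Proof. by apply/smooth_onP => i j; exact: smooth_fun_cst. Qed.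

Lemma smooth_onD F G : smooth_on c F -> smooth_on c G ->
  smooth_on c (fun x => F x + G x).
Proof.
move=> /smooth_onP sF /smooth_onP sG; apply/smooth_onP => i j.
by apply: (smooth_fun_ext openU _ (smooth_funD openU (sF i j) (sG i j))) => z _; rewrite mxE.
Qed.

Lemma smooth_onZ (a : R[i]) F : smooth_on c F -> smooth_on c (fun x => a *: F x).
Proof.
move=> /smooth_onP sF; apply/smooth_onP => i j.
by apply: (smooth_fun_ext openU _ (smooth_funM openU (smooth_fun_cst openU a) (sF i j))) => z _;
  rewrite mxE.
Qed.

Lemma smooth_onN F : smooth_on c F -> smooth_on c (fun x => - F x).
Proof. by move=> /(smooth_onZ (-1)); apply: smooth_on_ext => x _; rewrite scaleN1r. Qed.

Lemma smooth_onB F G : smooth_on c F -> smooth_on c G ->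
  smooth_on c (fun x => F x - G x).
Proof. by move=> sF /smooth_onN sG; exact: smooth_onD. Qed.

Lemma smooth_on_dz F : smooth_on c F -> smooth_on c (dz c F).
Proof.
move=> /smooth_onP sF; apply/smooth_onP => i j.
apply: (smooth_fun_ext openU _ (smooth_fun_dz openU (sF i j))) => z /chartK[_ zK].
by rewrite mxE zK.
Qed.

Lemma smooth_on_dzbar F : smooth_on c F -> smooth_on c (dzbar c F).
Proof.
move=> /smooth_onP sF; apply/smooth_onP => i j.
apply: (smooth_fun_ext openU _ (smooth_fun_dzbar openU (sF i j))) => z /chartK[_ zK].
by rewrite mxE zK.
Qed.

Lemma dz_ext F G x : cdom c x -> (forall y, cdom c y -> F y = G y) ->
  dz c F x = dz c G x.
Proof.
move=> cx FG; apply/matrixP => i j; rewrite !mxE.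
by apply: (plane_dz_ext openU (chart_mem cx)) => z /chartK[cz _]; rewrite FG.
Qed.

Lemma dzbar_ext F G x : cdom c x -> (forall y, cdom c y -> F y = G y) ->
  dzbar c F x = dzbar c G x.
Proof.
move=> cx FG; apply/matrixP => i j; rewrite !mxE.
by apply: (plane_dzbar_ext openU (chart_mem cx)) => z /chartK[cz _]; rewrite FG.
Qed.

Lemma dz_cst (A : 'M[R[i]]_(p, q)) x : dz c (fun=> A) x = 0.
Proof. by apply/matrixP => i j; rewrite !mxE plane_dz_cst. Qed.

Lemma dzbar_cst (A : 'M[R[i]]_(p, q)) x : dzbar c (fun=> A) x = 0.
Proof. by apply/matrixP => i j; rewrite !mxE plane_dzbar_cst. Qed.

Lemma dzD F G x : smooth_on c F -> smooth_on c G -> cdom c x ->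
  dz c (fun y => F y + G y) x = dz c F x + dz c G x.
Proof.
move=> /smooth_onP sF /smooth_onP sG cx; apply/matrixP => i j; rewrite !mxE.
rewrite -(plane_dzD (sF i j) (sG i j) (chart_mem cx)).
by apply: (plane_dz_ext openU (chart_mem cx)) => z _; rewrite mxE.
Qed.

Lemma dzZ (a : R[i]) F x : smooth_on c F -> cdom c x ->
  dz c (fun y => a *: F y) x = a *: dz c F x.
Proof.
move=> /smooth_onP sF cx; apply/matrixP => i j; rewrite !mxE.
have := plane_dzM (smooth_fun_cst openU a) (sF i j) (chart_mem cx).
rewrite plane_dz_cst mul0r add0r => <-.
by apply: (plane_dz_ext openU (chart_mem cx)) => z _; rewrite mxE.
Qed.

Lemma dzN F x : smooth_on c F -> cdom c x -> dz c (fun y => - F y) x = - dz c F x.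
Proof.
move=> sF cx; rewrite -scaleN1r -(dzZ _ sF cx).
by apply: dz_ext => // y _; rewrite scaleN1r.
Qed.

Lemma dzB F G x : smooth_on c F -> smooth_on c G -> cdom c x ->
  dz c (fun y => F y - G y) x = dz c F x - dz c G x.
Proof. by move=> sF sG cx; rewrite (dzD sF (smooth_onN sG) cx) (dzN sG cx). Qed.

Lemma dz_dzbar_comm F x : smooth_on c F -> cdom c x ->
  dz c (dzbar c F) x = dzbar c (dz c F) x.
Proof.
move=> /smooth_onP sF cx; apply/matrixP => i j; rewrite !mxE.
transitivity (plane_dz (plane_dzbar (fun z => F (cinv c z) i j)) (cmap c x)).
  by apply: (plane_dz_ext openU (chart_mem cx)) => z /chartK[_ zK]; rewrite mxE zK.
rewrite (plane_dz_dzbar_comm openU (sF i j) (chart_mem cx)).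
by apply: (plane_dzbar_ext openU (chart_mem cx)) => z /chartK[_ zK]; rewrite mxE zK.
Qed.

(** Filled images and kernels are described only off isolated points; this is the continuity
    argument that carries identities across those points. *)
Lemma smooth_on_near0 F x0 : smooth_on c F -> cdom c x0 ->
  (\forall x \near x0^', cdom c x -> F x = 0) -> F x0 = 0.
Proof.
move=> /smooth_onP sF cx F0; apply/matrixP => i j; rewrite mxE.
have Ux := chart_mem cx.
have := smooth_fun_near0 (sF i j) Ux; rewrite cmapK //; apply.
have nU : nbhs (cmap c x0) U by exact: open_nbhs_nbhs.
(* The punctured neighbourhood is read as an implication with premise [y != x0]. This gives a plain
   neighbourhood, which can be pulled back along [cinv c]. *)
pose P : set M := fun y => y != x0 -> cdom c y -> F y = 0.
have nP : nbhs (cinv c (cmap c x0)) P.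
  by rewrite cmapK.
have ni : nbhs (cmap c x0) (cinv c @^-1` P) := cinv_continuous Ux nP.
have nQ : nbhs (cmap c x0) (fun z => z != cmap c x0 -> F (cinv c z) i j = 0).
  apply: filterS2 nU ni => z Uz Pz zx; have [cz zK] := chartK Uz.
  rewrite (Pz _ cz) ?mxE //.
  by apply: contra zx => /eqP <-; rewrite zK.
exact: nQ.
Qed.

End Basic.

Section Products.
Variables (p q r : nat).

Lemma smooth_onM (F : M -> 'M[R[i]]_(p, q)) (G : M -> 'M[R[i]]_(q, r)) :
  smooth_on c F -> smooth_on c G -> smooth_on c (fun x => F x *m G x).
Proof.
move=> /smooth_onP sF /smooth_onP sG; apply/smooth_onP => i j.
have h := smooth_fun_sum openU (index_enum _) (fun k => smooth_funM openU (sF i k) (sG k j)).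
by apply: (smooth_fun_ext openU _ h) => z _; rewrite mxE.
Qed.

Lemma dzM (F : M -> 'M[R[i]]_(p, q)) (G : M -> 'M[R[i]]_(q, r)) x :
  smooth_on c F -> smooth_on c G -> cdom c x ->
  dz c (fun y => F y *m G y) x = dz c F x *m G x + F x *m dz c G x.
Proof.
move=> /smooth_onP sF /smooth_onP sG cx; apply/matrixP => i j; rewrite !mxE.
have Ux := chart_mem cx.
transitivity (plane_dz (fun z => \sum_k (F (cinv c z) i k * G (cinv c z) k j)) (cmap c x)).
  by apply: (plane_dz_ext openU Ux) => z _; rewrite mxE.
rewrite (plane_dz_sum openU _ (fun k => smooth_funM openU (sF i k) (sG k j)) Ux) -big_split /=.
apply: eq_bigr => k _; rewrite (plane_dzM (sF i k) (sG k j) Ux) !mxE cmapK //.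
Qed.

Lemma dzbarM (F : M -> 'M[R[i]]_(p, q)) (G : M -> 'M[R[i]]_(q, r)) x :
  smooth_on c F -> smooth_on c G -> cdom c x ->
  dzbar c (fun y => F y *m G y) x = dzbar c F x *m G x + F x *m dzbar c G x.
Proof.
move=> /smooth_onP sF /smooth_onP sG cx; apply/matrixP => i j; rewrite !mxE.
have Ux := chart_mem cx.
transitivity (plane_dzbar (fun z => \sum_k (F (cinv c z) i k * G (cinv c z) k j)) (cmap c x)).
  by apply: (plane_dzbar_ext openU Ux) => z _; rewrite mxE.
rewrite (plane_dzbar_sum openU _ (fun k => smooth_funM openU (sF i k) (sG k j)) Ux) -big_split /=.
apply: eq_bigr => k _; rewrite (plane_dzbarM (sF i k) (sG k j) Ux) !mxE cmapK //.
Qed.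

End Products.

Lemma smooth_on_adj p q (F : M -> 'M[R[i]]_(p, q)) :
  smooth_on c F -> smooth_on c (fun x => (F x)^t*).
Proof.
move=> /smooth_onP sF; apply/smooth_onP => i j.
by apply: (smooth_fun_ext openU _ (smooth_fun_conj openU (sF j i))) => z _; rewrite !mxE.
Qed.

Lemma dz_adj p q (F : M -> 'M[R[i]]_(p, q)) x : smooth_on c F -> cdom c x ->
  dz c (fun y => (F y)^t*) x = (dzbar c F x)^t*.
Proof.
move=> /smooth_onP sF cx; apply/matrixP => i j; rewrite !mxE.
rewrite -(plane_dz_conj (sF j i) (chart_mem cx)).
by apply: (plane_dz_ext openU (chart_mem cx)) => z _; rewrite !mxE.
Qed.

Lemma smooth_on_sum (I : finType) p q (F : I -> M -> 'M[R[i]]_(p, q)) :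
  (forall i, smooth_on c (F i)) -> smooth_on c (fun x => \sum_i F i x).
Proof.
move=> sF; elim: (index_enum I) => [|i s IH].
  by apply: smooth_on_ext (smooth_on_cst 0) => x _; rewrite big_nil.
by apply: smooth_on_ext (smooth_onD (sF i) IH) => x _; rewrite big_cons.
Qed.

End MatrixFields.

(** * Gauss bundles *)

Section ProjectionAlgebra.
Context {A : pzRingType}.
Implicit Types (P Q T D L : A).

(** The hypothesis on [D] is the derivative of [P * P = P]. It says that [D] is off-diagonal for the
    splitting defined by [P], and the three identities are forms of this. *)
Lemma idem_der P D : P * P = P -> D * P + P * D = D ->
  [/\ D * P = (1 - P) * D, D * (1 - P) = P * D & P * D * P = 0].
Proof.
move=> PP DP; have e1 : D * P = (1 - P) * D.
  by rewrite mulrBl mul1r -[X in X - _]DP addrK.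
split=> //; first by rewrite mulrBr mulr1 -[X in X - _]DP addrAC subrr add0r.
by rewrite -mulrA e1 mulrA mulrBr mulr1 PP subrr mul0r.
Qed.

Lemma idem_compl P : P * P = P -> (1 - P) * P = 0 /\ P * (1 - P) = 0.
Proof. by move=> PP; rewrite mulrBl mulrBr mul1r mulr1 PP subrr. Qed.

(* P is a harmonic projection, Q the projection onto the image of Pz P, and the
   suffixes z and b stand for the derivatives in z and zbar, so that L is the
   mixed derivative of P. *)
Lemma gauss_antiholo P Pz Pb L Q Qb :
  P * P = P -> Pz * P + P * Pz = Pz -> Pb * P + P * Pb = Pb ->
  (1 - P) * L * P = 0 -> P * Q = 0 -> Q * P = 0 ->
  Qb * (Pz * P) + Q * (L * P + Pz * Pb) = L * P + Pz * Pb ->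
  (1 - P) * Qb * (Pz * P) = 0.
Proof.
move=> PP dz db LP PQ QP dQ.
have [_ z2 _] := idem_der PP dz; have [b1 _ _] := idem_der PP db.
have [PcP _] := idem_compl PP.
(* [L * P + Pz * Pb] is the zbar-derivative of [Pz * P]. Restricted to [P] it takes values in [P]:
   the first term by harmonicity, the second because [Pz] and [Pb] are both off-diagonal. *)
have KbP : (L * P + Pz * Pb) * P = L * P + P * Pz * Pb.
  by rewrite mulrDl -!mulrA PP b1 !mulrA z2.
have PcKb : (1 - P) * (L * P + P * Pz * Pb) = 0.
  by rewrite mulrDr !mulrA LP PcP !mul0r addr0.
have QPc : (1 - P) * (1 - Q) = (1 - Q) * (1 - P).
  by rewrite !mulrBr !mulrBl !mul1r !mulr1 PQ QP !subr0 addrAC.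
have E : Qb * (Pz * P) = (1 - Q) * (L * P + Pz * Pb).
  by rewrite mulrBl mul1r -[X in X - _]dQ addrK.
have {}E : Qb * (Pz * P) = (1 - Q) * (L * P + P * Pz * Pb).
  by have := congr1 (fun X => X * P) E; rewrite -!mulrA PP KbP -!mulrA.
by rewrite -mulrA E mulrA QPc -mulrA PcKb mulr0.
Qed.

(** With [L'] the mixed derivative of [Q], the components of [L' * Q] in [P] and in [1 - P] are
    treated separately. The first vanishes by the mixed derivative of [P * Q = 0], the second, up to
    [Q], by the z-derivative of the conclusion of [gauss_antiholo]; these are the last two
    hypotheses. *)
Lemma gauss_harmonic P Pz Pb L Q Qz Qb L' :
  P * P = P -> Pz * P + P * Pz = Pz -> Q * Q = Q ->
  Qz * Q + Q * Qz = Qz -> Qb * Q + Q * Qb = Qb ->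
  P * Q = 0 -> Q * P = 0 -> P * L * (1 - P) = 0 ->
  (1 - Q) * (Pz * P) = 0 -> P * Pb * (1 - Q) = 0 ->
  (1 - P) * Qb * Q = 0 -> - Pz * Qb * Q + (1 - P) * (L' * Q + Qb * Qz) = 0 ->
  L * Q + Pb * Qz + (Pz * Qb + P * L') = 0 ->
  (1 - Q) * L' * Q = 0.
Proof.
move=> PP dz QQ dQz dQb PQ QP PL f5 f6 f1 f2 f3.
have [_ _ PzP] := idem_der PP dz.
have [z1 z2 _] := idem_der QQ dQz; have [_ b2 _] := idem_der QQ dQb.
have [QcQ QQc] := idem_compl QQ.
have PcQ : (1 - P) * Q = Q by rewrite mulrBl mul1r PQ subr0.
have QcP : (1 - Q) * P = P by rewrite mulrBl mul1r QP subr0.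
have J : Qb * Q = P * (Qb * Q).
  by apply/eqP; rewrite -subr_eq0 -{1}[Qb * Q]mul1r -mulrBl mulrA f1.
have PL'Q : P * L' * Q = 0.
  have := congr1 (fun X => P * X * Q) f3.
  have e1 : P * L * Q = 0 by rewrite -[in LHS]PcQ mulrA PL mul0r.
  have e2 : P * (Pb * Qz) * Q = 0 by rewrite -!mulrA z1 !mulrA f6 mul0r.
  have e3 : P * (Pz * Qb) * Q = 0 by rewrite -!mulrA J !mulrA PzP !mul0r.
  rewrite mulr0 mul0r !mulrDr !mulrDl e2 e3 -!mulrA QQ (mulrA P P) PP !mulrA e1.
  by rewrite !add0r.
have PcL'Q : (1 - Q) * ((1 - P) * L') * Q = 0.
  have := congr1 (fun X => (1 - Q) * X * Q) f2.
  have e1 : (1 - Q) * (- Pz * Qb * Q) * Q = 0.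
    by rewrite !mulNr mulrN mulNr -!mulrA QQ J (mulrA Pz) mulrA f5 mul0r oppr0.
  have e2 : (1 - Q) * ((1 - P) * (Qb * Qz)) * Q = 0.
    by rewrite -!mulrA z1 (mulrA Qb) b2 -!mulrA (mulrA (1 - P)) PcQ mulrA QcQ mul0r.
  by rewrite mulr0 mul0r mulrDr mulrDl e1 add0r !mulrDr mulrDl e2 addr0 -!mulrA QQ.
have -> : (1 - Q) * L' = (1 - Q) * P * L' + (1 - Q) * ((1 - P) * L').
  by rewrite -mulrA -mulrDr -mulrDl [P + _]addrC subrK mul1r.
by rewrite mulrDl QcP PL'Q PcL'Q addr0.
Qed.

(** The last hypothesis, adjoint to the conclusion of [gauss_antiholo], gives [Q * Qz = Q * Qz * P];
    the derivative of [Q * P = 0] then evaluates the right-hand side. *)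
Lemma gauss_adjoint_ff P Pz Q Qz :
  P * P = P -> Q * Q = Q -> Qz * P + Q * Pz = 0 ->
  Q * (Pz * P) = Pz * P -> Q * Qz * (1 - P) = 0 -> Q * Qz = - (Pz * P).
Proof.
move=> PP QQ dQP QK /eqP; rewrite mulrBr mulr1 subr_eq0 => /eqP ->.
rewrite -QK; have := congr1 (fun X => Q * X * P) dQP.
rewrite mulr0 mul0r mulrDr mulrDl -!mulrA PP (mulrA Q Q) QQ => /eqP.
by rewrite addr_eq0 => /eqP.
Qed.

End ProjectionAlgebra.

(** * The Gauss bundle of a single harmonic subbundle *)

Section GaussBundles.
Context {R : realType} {M : riemann_surface R} {n : nat}.
Local Notation mxfield := (M -> 'M[R[i]]_n).
Implicit Types (psi chi Q : mxfield) (c : chart M) (x : M).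

Lemma ctrmxM p q r (A : 'M[R[i]]_(p, q)) (B : 'M[R[i]]_(q, r)) :
  (A *m B)^t* = B^t* *m A^t*.
Proof. by rewrite trmx_mul map_mxM. Qed.

Lemma ctrmxK p q (A : 'M[R[i]]_(p, q)) : (A^t*)^t* = A.
Proof. by apply/matrixP => i j; rewrite !mxE conjCK. Qed.

Lemma ctrmxB p q (A B : 'M[R[i]]_(p, q)) : (A - B)^t* = A^t* - B^t*.
Proof. by rewrite linearB map_mxB. Qed.

Lemma ctrmx1 : (1%:M : 'M[R[i]]_n)^t* = 1%:M.
Proof. by rewrite trmx1 map_mx1. Qed.

Lemma ctrmx0 p q : (0 : 'M[R[i]]_(p, q))^t* = 0.
Proof. by rewrite trmx0 map_mx0. Qed.

Lemma mx_eq0_vec p q (A : 'M[R[i]]_(p, q)) : (forall v : 'cV_q, A *m v = 0) -> A = 0.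
Proof.
move=> A0; apply/matrixP => i j; have := A0 (delta_mx j 0).
by rewrite -colE => /matrixP /(_ i 0); rewrite !mxE.
Qed.

Section Subbundle.
Variables (psi : mxfield) (c : chart M) (x : M).
Hypotheses (sub : subbundle psi) (cx : cdom c x).

Lemma subbundle_smooth : smooth_on c psi. Proof. by case: sub => s _; exact: s. Qed.

Lemma subbundle_herm y : (psi y)^t* = psi y.
Proof. by case: sub => _ /(_ y)[]. Qed.

Lemma subbundle_idem y : psi y *m psi y = psi y.
Proof. by case: sub => _ /(_ y)[]. Qed.

Lemma dz_idem : dz c psi x *m psi x + psi x *m dz c psi x = dz c psi x.
Proof.
rewrite -(dzM subbundle_smooth subbundle_smooth cx).
by apply: dz_ext => // y _; exact: subbundle_idem.
Qed.

Lemma dzbar_idem : dzbar c psi x *m psi x + psi x *m dzbar c psi x = dzbar c psi x.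
Proof.
rewrite -(dzbarM subbundle_smooth subbundle_smooth cx).
by apply: dzbar_ext => // y _; exact: subbundle_idem.
Qed.

Lemma adj_dz : (dz c psi x)^t* = dzbar c psi x.
Proof.
rewrite -[RHS]ctrmxK -(dz_adj subbundle_smooth cx); congr (_^t*).
by apply: dz_ext => // y _; rewrite subbundle_herm.
Qed.

End Subbundle.

Lemma adj_dzbar_dz psi c x : subbundle psi -> cdom c x ->
  (dzbar c (dz c psi) x)^t* = dzbar c (dz c psi) x.
Proof.
move=> sub cx; have s := subbundle_smooth c sub.
rewrite -(dz_adj (smooth_on_dz s) cx) -(dz_dzbar_comm s cx).
by apply: dz_ext => // y cy; rewrite (adj_dz sub cy).
Qed.

Lemma subbundle_perp psi : subbundle psi -> subbundle (perp psi).
Proof.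
move=> sub; split.
  by move=> c; apply: smooth_onB; [exact: smooth_on_cst|exact: subbundle_smooth].
move=> x; rewrite /perp ctrmxB ctrmx1 (subbundle_herm sub); split=> //.
by rewrite mulmxBr mulmx1 mulmxBl mul1mx (subbundle_idem sub) subrr subr0.
Qed.

Section Filling.
Variables (psi Q : mxfield) (T : chart M -> M -> 'M[R[i]]_n) (c : chart M).
Hypothesis sub : subbundle psi.

(** At generic points every vector of [Q] is a value of [T] on [psi], so [X Q] vanishes there; being
    smooth, it vanishes at the filled points too. *)
Lemma filled_image_kill p (X : M -> 'M[R[i]]_(p, n)) : filled_image psi T Q ->
  smooth_on c X -> (forall x, cdom c x -> X x *m (T c x *m psi x) = 0) ->
  forall x, cdom c x -> X x *m Q x = 0.
Proof.
move=> [subQ imQ] sX XT x cx.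
have sF := smooth_onM sX (subbundle_smooth c subQ).
apply: (smooth_on_near0 sF cx); apply: filterS (imQ x) => y hy cy.
apply: mx_eq0_vec => v; rewrite -mulmxA.
have /(hy _ cy)[w pw ->] : fibre Q y (Q y *m v).
  by rewrite /fibre mulmxA subbundle_idem.
by rewrite -pw !mulmxA -(mulmxA (X y)) XT // mul0mx.
Qed.

Lemma filled_image_mem : filled_image psi T Q -> smooth_on c (T c) ->
  forall x, cdom c x -> Q x *m (T c x *m psi x) = T c x *m psi x.
Proof.
move=> [subQ imQ] sT x cx.
have sP : smooth_on c (fun y => T c y *m psi y) := smooth_onM sT (subbundle_smooth c sub).
have sF := smooth_onB (smooth_onM (subbundle_smooth c subQ) sP) sP.
apply/eqP; rewrite -subr_eq0; apply/eqP.
apply: (smooth_on_near0 sF cx); apply: filterS (imQ x) => y hy cy.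
apply: mx_eq0_vec => v; rewrite mulmxBl; apply/eqP; rewrite subr_eq0 -!mulmxA; apply/eqP.
apply/(hy _ cy); exists (psi y *m v) => //.
by rewrite /fibre mulmxA subbundle_idem.
Qed.

Lemma filled_kernel_kill : filled_kernel psi T Q -> smooth_on c (T c) ->
  forall x, cdom c x -> T c x *m Q x = 0.
Proof.
move=> [subQ kerQ] sT x cx.
have sF := smooth_onM sT (subbundle_smooth c subQ).
apply: (smooth_on_near0 sF cx); apply: filterS (kerQ x) => y hy cy.
apply: mx_eq0_vec => v; rewrite -mulmxA.
have : fibre Q y (Q y *m v) by rewrite /fibre mulmxA subbundle_idem.
by case/(hy _ cy).
Qed.

End Filling.

Lemma smooth_second_ff psi chi c : subbundle psi -> subbundle chi ->
  smooth_on c (second_ff psi chi c).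
Proof.
move=> sp sc; have s := subbundle_smooth c sp.
exact: (smooth_onM (smooth_onM (subbundle_smooth c sc) (smooth_on_dz s)) s).
Qed.

Lemma second_ff_perp psi c x : subbundle psi -> cdom c x ->
  second_ff psi (perp psi) c x = dz c psi x *m psi x.
Proof.
move=> sub cx; have [e _ _] := idem_der (subbundle_idem sub x) (dz_idem sub cx).
have e' : dz c psi x *m psi x = perp psi x *m dz c psi x := e.
by rewrite /second_ff -e' -mulmxA subbundle_idem.
Qed.

(** One off-diagonal block of the harmonic equation. The mixed derivative of a Hermitian field is
    Hermitian, so the other block is its adjoint, as [harmonic_on_adj] shows. *)
Definition harmonic_on c psi := forall x, cdom c x ->
  perp psi x *m dzbar c (dz c psi) x *m psi x = 0.

Lemma harmonic_on_adj c psi x : subbundle psi -> harmonic_on c psi -> cdom c x ->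
  psi x *m dzbar c (dz c psi) x *m perp psi x = 0.
Proof.
move=> sub h cx; have := congr1 (fun X => X^t*) (h x cx).
by rewrite !ctrmxM (adj_dzbar_dz sub cx) (subbundle_herm sub)
  (subbundle_herm (subbundle_perp sub)) ctrmx0 mulmxA.
Qed.

Section GaussStep.
Variables (psi Q : mxfield) (c : chart M).
Hypotheses (sub : subbundle psi) (harm : harmonic_on c psi)
  (QE : filled_image psi (second_ff psi (perp psi)) Q).

Let subQ : subbundle Q. Proof. by case: QE. Qed.

Lemma gauss_perp x : cdom c x -> psi x *m Q x = 0 /\ Q x *m psi x = 0.
Proof.
move=> cx; have e : psi x *m Q x = 0.
  apply: (filled_image_kill QE (subbundle_smooth c sub)) cx => y cy.
  rewrite /second_ff !mulmxA /perp mulmxBr mulmx1 (subbundle_idem sub) subrr.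
  by rewrite !mul0mx.
split=> //; have := congr1 (fun X => X^t*) e.
by rewrite ctrmxM (subbundle_herm sub) (subbundle_herm subQ) ctrmx0.
Qed.

Lemma gauss_mem x : cdom c x -> Q x *m (dz c psi x *m psi x) = dz c psi x *m psi x.
Proof.
move=> cx; have s := smooth_second_ff c sub (subbundle_perp sub).
have := filled_image_mem sub QE s cx.
by rewrite (second_ff_perp sub cx) -mulmxA (subbundle_idem sub).
Qed.

Lemma gauss_kill p (X : M -> 'M[R[i]]_(p, n)) : smooth_on c X ->
  (forall x, cdom c x -> X x *m (dz c psi x *m psi x) = 0) ->
  forall x, cdom c x -> X x *m Q x = 0.
Proof.
move=> sX XK; apply: (filled_image_kill QE sX) => x cx.
by rewrite (second_ff_perp sub cx) -mulmxA (subbundle_idem sub) XK.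
Qed.

Let sp := subbundle_smooth c sub.
Let sQ := subbundle_smooth c subQ.
Let spz := smooth_on_dz sp.
Let sQb := smooth_on_dzbar sQ.

(** It is enough to test on the values of [A'_psi], which generically fill [Q]. The meaning is that
    the zbar-derivative of a section of [Q] stays in the sum of [Q] and [psi]. *)
Lemma gauss_dzbar x : cdom c x -> perp psi x *m dzbar c Q x *m Q x = 0.
Proof.
have sperp := subbundle_smooth c (subbundle_perp sub).
apply: (gauss_kill (smooth_onM sperp sQb)) => y cy.
have [PQ QP] := gauss_perp cy.
apply: (@gauss_antiholo 'M[R[i]]_n (psi y) (dz c psi y) (dzbar c psi y)
  (dzbar c (dz c psi) y) (Q y) (dzbar c Q y)).
- exact: subbundle_idem.
- exact: dz_idem.
- exact: dzbar_idem.
- exact: harm.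
- exact: PQ.
- exact: QP.
have sK := smooth_onM spz sp.
have KE : dzbar c (fun y => dz c psi y *m psi y) y =
    dzbar c (dz c psi) y *m psi y + dz c psi y *m dzbar c psi y.
  exact: dzbarM.
rewrite -[LHS]/(dzbar c Q y *m (dz c psi y *m psi y) +
  Q y *m (dzbar c (dz c psi) y *m psi y + dz c psi y *m dzbar c psi y)) -KE.
rewrite -(dzbarM sQ sK cy).
by apply: dzbar_ext => // t ct; exact: gauss_mem.
Qed.

(** [Q dz Q] is minus the block of [d_z] from the complement of [Q] into [Q]. By the adjoint of
    [gauss_dzbar] only [psi] contributes to it, through [A'_psi]. *)
Lemma gauss_dz x : cdom c x -> Q x *m dz c Q x = - (dz c psi x *m psi x).
Proof.
move=> cx; have [PQ QP] := gauss_perp cx.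
apply: (@gauss_adjoint_ff 'M[R[i]]_n (psi x) (dz c psi x) (Q x) (dz c Q x)).
- exact: subbundle_idem.
- exact: subbundle_idem.
- have := dzM sQ sp cx; rewrite -[in RHS]/(dz c Q x *m psi x + Q x *m dz c psi x).
  move=> <-; rewrite -[RHS](dz_cst c (0 : 'M[R[i]]_n) x).
  by apply: dz_ext => // y cy; case: (gauss_perp cy).
- exact: gauss_mem.
have := congr1 (fun X => X^t*) (gauss_dzbar cx).
rewrite !ctrmxM ctrmx0 -(adj_dz subQ cx) ctrmxK (subbundle_herm subQ).
by rewrite (subbundle_herm (subbundle_perp sub)) mulmxA.
Qed.

Lemma gauss_harmonic_on : harmonic_on c Q.
Proof.
move=> x cx; have [PQ QP] := gauss_perp cx.
have f5 : perp Q x *m (dz c psi x *m psi x) = 0.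
  by rewrite mulmxBl mul1mx gauss_mem // subrr.
apply: (@gauss_harmonic 'M[R[i]]_n (psi x) (dz c psi x) (dzbar c psi x)
  (dzbar c (dz c psi) x) (Q x) (dz c Q x) (dzbar c Q x) (dzbar c (dz c Q) x)).
- exact: subbundle_idem.
- exact: dz_idem.
- exact: subbundle_idem.
- exact: dz_idem.
- exact: dzbar_idem.
- exact: PQ.
- exact: QP.
- exact: harmonic_on_adj.
- exact: f5.
- have := congr1 (fun X => X^t*) f5.
  by rewrite !ctrmxM ctrmx0 (adj_dz sub cx) (subbundle_herm sub)
    (subbundle_herm (subbundle_perp subQ)).
- exact: gauss_dzbar.
- have sperp := subbundle_smooth c (subbundle_perp sub).
  have s1 : smooth_on c (fun y => dzbar c Q y *m Q y) := smooth_onM sQb sQ.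
  have E : dz c (fun y => perp psi y *m (dzbar c Q y *m Q y)) x = 0.
    rewrite -[RHS](dz_cst c (0 : 'M[R[i]]_n) x).
    by apply: dz_ext => // y cy; rewrite mulmxA gauss_dzbar.
  rewrite -[RHS]E (dzM sperp s1 cx) (dzM sQb sQ cx) (dz_dzbar_comm sQ cx).
  have -> : dz c (perp psi) x = - dz c psi x.
    by rewrite (dzB (smooth_on_cst c _) sp cx) dz_cst sub0r.
  by congr (_ + _); rewrite mulmxA.
have spb := smooth_on_dzbar sp.
have E : dz c (fun y => dzbar c psi y *m Q y + psi y *m dzbar c Q y) x = 0.
  rewrite -[RHS](dz_cst c (0 : 'M[R[i]]_n) x); apply: dz_ext => // y cy.
  rewrite -(dzbarM sp sQ cy) -[RHS](dzbar_cst c (0 : 'M[R[i]]_n) y).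
  by apply: dzbar_ext => // t ct; case: (gauss_perp ct).
rewrite -[RHS]E (dzD (smooth_onM spb sQ) (smooth_onM sp sQb) cx).
by rewrite (dzM spb sQ cx) (dzM sp sQb cx) (dz_dzbar_comm sQ cx) (dz_dzbar_comm sp cx).
Qed.

End GaussStep.

End GaussBundles.

(** * The Gauss sequence up to the isotropy order, and the components of d_z *)

Section GaussSequence.
Context {R : realType} {M : riemann_surface R} {n : nat}.
Variables (phi : M -> 'M[R[i]]_n) (G : nat -> M -> 'M[R[i]]_n) (r : nat) (c : chart M).
Hypotheses (phi_sub : subbundle phi) (phi_harmonic : harmonic_grassmann phi)
  (G_phi : gauss_bundles phi G) (G_iso : isotropic_upto phi G r).

Lemma gauss0 : G 0%N = phi. Proof. by case: G_phi => h _; apply/funext. Qed.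

Lemma gauss_sub i : subbundle (G i).
Proof. by case: i => [|i]; [rewrite gauss0|case: G_phi => _ /(_ i)[]]. Qed.

Let sG i : smooth_on c (G i) := subbundle_smooth c (gauss_sub i).

Let imG i : filled_image (G i) (second_ff (G i) (perp (G i))) (G i.+1).
Proof. by case: G_phi. Qed.

Lemma gauss_harm i : harmonic_on c (G i).
Proof.
elim: i => [|i IH]; last exact: gauss_harmonic_on (gauss_sub i) IH (imG i).
rewrite gauss0 => x cx; have := phi_harmonic cx; rewrite /=.
set L := dzbar _ _ _ => h.
have pp : perp phi x *m phi x = 0.
  by rewrite mulmxBl mul1mx (subbundle_idem phi_sub) subrr.
have := congr1 (fun X => perp phi x *m X *m phi x) h.
rewrite mulmx0 mul0mx mulmxDr mulmxDl !mulmxA pp !mul0mx add0r.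
rewrite (subbundle_idem (subbundle_perp phi_sub)) -!mulmxA (subbundle_idem phi_sub).
by rewrite !mulmxA.
Qed.

Let gaussD i x : cdom c x ->
  G i.+1 x *m dz c (G i.+1) x = - (dz c (G i) x *m G i x).
Proof. by move=> cx; exact: gauss_dz (gauss_sub i) (@gauss_harm i) (imG i) _ cx. Qed.

Let gaussK i x : cdom c x ->
  G i.+1 x *m (dz c (G i) x *m G i x) = dz c (G i) x *m G i x.
Proof. by move=> cx; exact: gauss_mem (gauss_sub i) (imG i) _ cx. Qed.

Lemma dz_orth (P Q : M -> 'M[R[i]]_n) x : smooth_on c P -> smooth_on c Q ->
  (forall y, cdom c y -> P y *m Q y = 0) -> cdom c x ->
  dz c P x *m Q x = - (P x *m dz c Q x).
Proof.
move=> sP sQ PQ cx; apply/eqP; rewrite -addr_eq0 -(dzM sP sQ cx); apply/eqP.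
by rewrite -[RHS](dz_cst c (0 : 'M[R[i]]_n) x); apply: dz_ext.
Qed.

(** Isotropy is the case [i = 0], and adjacent bundles are orthogonal by construction. To pass from
    [G k] to [G k.+1], the derivative of [G i.+1 G k = 0] moves [d_z] onto [G i.+1], where
    [gauss_dz] turns it into a map factoring through [G i]; the outer induction makes [G i]
    orthogonal to [G k]. *)
Lemma gauss_orth i j x : (i < j <= i + r)%N -> cdom c x -> G i x *m G j x = 0.
Proof.
elim: i j x => [|i IHi] j x.
  rewrite add0n gauss0 => ij cx; apply/matrixP => k l.
  have kp : fibre phi x (phi x *m delta_mx k 0).
    by rewrite /fibre mulmxA (subbundle_idem phi_sub).
  have lp : fibre (G j) x (G j x *m delta_mx l 0).
    by rewrite /fibre mulmxA (subbundle_idem (gauss_sub j)).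
  have := G_iso ij kp lp; rewrite ctrmxM (subbundle_herm phi_sub) trmx_delta map_delta_mx.
  by rewrite !mulmxA -!(mulmxA (delta_mx 0 k)) -rowE -colE => /matrixP /(_ 0 0); rewrite !mxE.
move=> /andP[ij jir] cx.
have [d jE] : exists d, j = (i.+2 + d)%N by exists (j - i.+2)%N; rewrite subnKC.
have dr : (d < r)%N by lia.
rewrite jE.
elim: d dr x cx {j jE ij jir} => [|d IHd] dr x cx.
  by rewrite addn0; case: (gauss_perp (gauss_sub i.+1) (imG i.+1) cx).
rewrite addnS; set k := (i.+2 + d)%N in IHd *.
have orthk y : cdom c y -> G i.+1 y *m G k y = 0 by apply: IHd; lia.
apply: (gauss_kill (gauss_sub k) (imG k) (sG i.+1)) cx => y cy.
have e0 := dz_orth (sG _) (sG _) orthk cy.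
have -> : G i.+1 y *m (dz c (G k) y *m G k y) = - (dz c (G i.+1) y *m G k y).
  by rewrite -(subbundle_idem (gauss_sub k)) !mulmxA e0 mulNmx opprK -mulmxA
    (subbundle_idem (gauss_sub k)).
apply/eqP; rewrite oppr_eq0; apply/eqP.
have [_ e _] := idem_der (subbundle_idem (gauss_sub i.+1) y) (dz_idem (gauss_sub i.+1) cy).
have e' : dz c (G i.+1) y *m perp (G i.+1) y = G i.+1 y *m dz c (G i.+1) y := e.
have -> : G k y = perp (G i.+1) y *m G k y by rewrite mulmxBl mul1mx orthk // subr0.
rewrite mulmxA e' gaussD // mulNmx -mulmxA IHi ?mulmx0 ?oppr0 //.
by rewrite /k; lia.
Qed.

Lemma gauss_orthC i j x : (i <= r)%N -> (j <= r)%N -> i != j -> cdom c x ->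
  G i x *m G j x = 0.
Proof.
move=> ir jr ij cx; have [lt|lt|e] := ltngtP i j; last by rewrite e eqxx in ij.
  by apply: gauss_orth; rewrite // lt (leq_trans jr) ?leq_addl.
have := congr1 (fun X => X^t*) (@gauss_orth j i x _ cx).
rewrite ctrmxM ctrmx0 !(subbundle_herm (gauss_sub _)); apply.
by rewrite lt (leq_trans ir) ?leq_addl.
Qed.

Local Notation Rm := (remainder G r).

Lemma remainder_gauss i x : (i <= r)%N -> cdom c x -> Rm x *m G i x = 0.
Proof.
move=> ir cx; rewrite /remainder /perp mulmxBl mul1mx mulmx_suml.
rewrite (bigD1 (Ordinal (ir : (i < r.+1)%N))) //= (subbundle_idem (gauss_sub i)).
rewrite big1 ?addr0 ?subrr // => j ji; apply: gauss_orthC => //.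
by rewrite -ltnS.
Qed.

Lemma remainder_idem x : cdom c x -> Rm x *m Rm x = Rm x.
Proof.
move=> cx; rewrite {2}/remainder /perp mulmxBr mulmx1 mulmx_sumr big1 ?subr0 // => i _.
by rewrite remainder_gauss // -ltnS.
Qed.

Lemma gauss_remainder i x : (i <= r)%N -> cdom c x -> G i x *m Rm x = 0.
Proof.
move=> ir cx; rewrite /remainder /perp mulmxBr mulmx1 mulmx_sumr.
rewrite (bigD1 (Ordinal (ir : (i < r.+1)%N))) //= (subbundle_idem (gauss_sub i)).
rewrite big1 ?addr0 ?subrr // => j ji; apply: gauss_orthC => //.
  by rewrite -ltnS.
by apply: contra ji => /eqP e; apply/eqP/val_inj; rewrite /= e.
Qed.

Lemma smooth_remainder : smooth_on c Rm.
Proof. by apply: smooth_onB; [exact: smooth_on_cst|exact: smooth_on_sum]. Qed.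

Section Components.
Variables (s : M -> 'cV[R[i]]_n) (x : M).
Hypotheses (s_smooth : smooth_on c s) (cx : cdom c x).

(** The arrow [G i -> G i.+1] is the only one by which [d_z] enters [G i.+1]. *)
Lemma dz_gauss i : G i.+1 x *m dz c s x =
  G i.+1 x *m dz c (fun y => G i.+1 y *m s y) x +
  second_ff (G i) (perp (G i)) c x *m s x.
Proof.
rewrite (dzM (sG _) s_smooth cx) mulmxDr !mulmxA gaussD // (subbundle_idem (gauss_sub _)).
by rewrite (second_ff_perp (gauss_sub i) cx) mulNmx [RHS]addrC addrA subrr add0r.
Qed.

Lemma gauss_dz_gauss i : (i < r)%N -> forall X : 'M[R[i]]_n,
  X *m G i.+1 x = 0 -> X *m dz c (G i) x *m G i x = 0.
Proof. by move=> ir X XG; rewrite -mulmxA -gaussK // mulmxA XG mul0mx. Qed.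

(** For [i < r] the second fundamental form of [G i] lands in [G i.+1], which the remainder
    annihilates; hence [d_z] enters the remainder from [G r] alone. *)
Lemma dz_remainder : Rm x *m dz c s x =
  Rm x *m dz c (fun y => Rm y *m s y) x + second_ff (G r) Rm c x *m s x.
Proof.
have sR := smooth_remainder.
rewrite (dzM sR s_smooth cx) mulmxDr !mulmxA remainder_idem //.
suff -> : Rm x *m dz c Rm x = - second_ff (G r) Rm c x.
  by rewrite mulNmx [RHS]addrC addrA subrr add0r.
have idR : dz c Rm x *m Rm x + Rm x *m dz c Rm x = dz c Rm x.
  by rewrite -(dzM sR sR cx); apply: dz_ext => // y cy; exact: remainder_idem.
have [_ e _] := idem_der (remainder_idem cx) idR.
have <- : dz c Rm x *m (1%:M - Rm x) = Rm x *m dz c Rm x := e.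
rewrite {2}/remainder /perp subKr mulmx_sumr big_ord_recr /= big1 => [|i _].
  rewrite add0r (dz_orth sR (sG r)) => [|y cy|//]; last exact: remainder_gauss.
  have [_ _ z] := idem_der (subbundle_idem (gauss_sub r) x) (dz_idem (gauss_sub r) cx).
  rewrite /second_ff; congr (- _).
  have d := dz_idem (gauss_sub r) cx; rewrite -[in LHS]d mulmxDr (mulmxA _ (G r x)).
  by rewrite remainder_gauss // mul0mx addr0 mulmxA.
have ir : (i < r)%N by [].
rewrite (dz_orth sR (sG i)) => [|y cy|//]; last by rewrite remainder_gauss // ltnW.
rewrite -(dz_idem (gauss_sub i) cx) mulmxDr (mulmxA _ (G i x)) remainder_gauss ?(ltnW ir) //.
by rewrite mul0mx addr0 mulmxA (gauss_dz_gauss ir) ?oppr0 // remainder_gauss.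
Qed.

End Components.

(** The left-hand side is the block of [d_z] from the complement of [phi] into [phi]. For
    [0 < i < r] the bundle [G i] is sent to [G i.+1], orthogonal to [phi], so only [G r] and the
    remainder contribute. *)
Lemma dz_phi x : (0 < r)%N -> cdom c x ->
  - (phi x *m dz c phi x) = second_ff (G r) phi c x + second_ff Rm phi c x.
Proof.
move=> r_gt0 cx; have sR := smooth_remainder.
have sphi := subbundle_smooth c phi_sub.
have orth i y : (0 < i <= r)%N -> cdom c y -> phi y *m G i y = 0.
  by move=> /andP[i0 ir] cy; rewrite -gauss0 gauss_orthC // eq_sym -lt0n.
have phiR y : cdom c y -> phi y *m Rm y = 0.
  by move=> cy; rewrite -gauss0 gauss_remainder.
have H Q : smooth_on c Q -> (forall y, cdom c y -> phi y *m Q y = 0) ->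
    Q x *m Q x = Q x -> phi x *m dz c phi x *m Q x = - second_ff Q phi c x.
  move=> sQ phiQ QQ; rewrite -{1}QQ mulmxA -(mulmxA (phi x)) (dz_orth sphi sQ) //.
  by rewrite mulmxN mulNmx !mulmxA (subbundle_idem phi_sub).
have -> : phi x *m dz c phi x =
    phi x *m dz c phi x *m (Rm x + \sum_(i < r.+1) G i x).
  by rewrite /remainder /perp subrK mulmx1.
have Hr : phi x *m dz c phi x *m G r x = - second_ff (G r) phi c x.
  apply: H => [//|y cy|]; last exact: (subbundle_idem (gauss_sub r)).
  by apply: orth; rewrite ?r_gt0 ?leqnn.
have HR : phi x *m dz c phi x *m Rm x = - second_ff Rm phi c x.
  by apply: H => //; exact: remainder_idem.
rewrite mulmxDr mulmx_sumr big_ord_recr /= big1 => [|i _].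
  by rewrite add0r Hr HR opprD !opprK addrC.
have [i0|i0] := posnP i.
  have [_ _ z] := idem_der (subbundle_idem phi_sub x) (dz_idem phi_sub cx).
  by rewrite i0 gauss0.
have ir : (i < r)%N by [].
have Hi : phi x *m dz c phi x *m G i x = - second_ff (G i) phi c x.
  apply: H; [exact: sG|move=> y cy|exact: (subbundle_idem (gauss_sub i))].
  by apply: orth cy; rewrite i0 ltnW.
have orth1 : phi x *m G i.+1 x = 0 by apply: orth cx; rewrite ltnS.
have z : phi x *m dz c (G i) x *m G i x = 0 := gauss_dz_gauss cx ir orth1.
by rewrite Hi /second_ff z oppr0.
Qed.

End GaussSequence.

(** * Unitons and the spectral parameter *)

Section Pencil.
Context {R : realType} {M : riemann_surface R} {n : nat} (c : chart M).
Local Notation mxfield := (M -> 'M[R[i]]_n).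
Local Notation vecfield := (M -> 'cV[R[i]]_n).
Implicit Types (A P Phi : mxfield) (w : nat -> vecfield).

(** Multiplication of the series by [mu]. *)
Definition shift_seq w : nat -> vecfield := fun q => if q is q'.+1 then w q' else fun=> 0.

(* A sequence w is the formal series \sum_q w_q mu^q; pencil A is the operator
   d_z + (1 - mu) A on such series. *)
Definition pencil A w : nat -> vecfield := fun q x =>
  dz c (w q) x + A x *m w q x - A x *m shift_seq w q x.

Definition smooth_seq w := forall q, smooth_on c (w q).

Definition degree_le d w := forall q x, (d < q)%N -> cdom c x -> w q x = 0.

(** The bound does not depend on [N]; this uniformity is what the proof extracts from a finite
    uniton number. *)
Definition degree_bounded A s := forall N d w, smooth_seq w -> degree_le d w ->
  degree_le (d + s) (iter N (pencil A) w).

Definition eq_seq w w' := forall q x, cdom c x -> w q x = w' q x.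

Lemma smooth_shift w : smooth_seq w -> smooth_seq (shift_seq w).
Proof. by move=> sw [|q]; [exact: smooth_on_cst|exact: sw]. Qed.

Lemma smooth_pencil A w : smooth_on c A -> smooth_seq w -> smooth_seq (pencil A w).
Proof.
move=> sA sw q; apply: smooth_onB.
  by apply: smooth_onD; [exact: smooth_on_dz|exact: smooth_onM].
by apply: smooth_onM sA _; exact: smooth_shift.
Qed.

Lemma smooth_iter_pencil A w N : smooth_on c A -> smooth_seq w ->
  smooth_seq (iter N (pencil A) w).
Proof. by move=> sA sw; elim: N => [|N IH]; [exact: sw|exact: smooth_pencil]. Qed.

Lemma eq_shift w w' : eq_seq w w' -> eq_seq (shift_seq w) (shift_seq w').
Proof. by move=> e [|q] x cx //=; exact: e. Qed.

Lemma eq_pencil A A' w w' : (forall x, cdom c x -> A x = A' x) -> eq_seq w w' ->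
  eq_seq (pencil A w) (pencil A' w').
Proof.
move=> eA ew q x cx; rewrite /pencil (eq_shift ew q cx) (ew q x cx) (eA x cx).
have e : dz c (w q) x = dz c (w' q) x := dz_ext cx (ew q).
by rewrite e.
Qed.

Lemma eq_iter_pencil A A' w w' N : (forall x, cdom c x -> A x = A' x) -> eq_seq w w' ->
  eq_seq (iter N (pencil A) w) (iter N (pencil A') w').
Proof. by move=> eA ew; elim: N => [|N IH]; [exact: ew|exact: eq_pencil eA IH]. Qed.

Lemma degree_bounded_ext A A' s : (forall x, cdom c x -> A x = A' x) ->
  degree_bounded A s -> degree_bounded A' s.
Proof.
move=> eA bA N d w sw dw q x hq cx.
have e : eq_seq w w by [].
by rewrite -(eq_iter_pencil N eA e q cx); exact: bA dw q x hq cx.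
Qed.

Lemma degree_bounded0 : degree_bounded (fun=> 0) 0.
Proof.
move=> N d w sw dw; rewrite addn0; elim: N => [|N IH]; first exact: dw.
move=> q x hq cx; rewrite iterS /pencil !mul0mx subr0 addr0 -[RHS](dz_cst c (0 : 'cV[R[i]]_n) x).
by apply: (dz_ext cx) => y; exact: IH.
Qed.

Lemma shift_pencil A w : eq_seq (shift_seq (pencil A w)) (pencil A (shift_seq w)).
Proof.
move=> [|q] x cx //=.
by rewrite /pencil /= dz_cst !mulmx0 addr0 subr0.
Qed.

Section Gauge.
Variables (A A' P : mxfield).
Hypotheses (sA : smooth_on c A) (sP : smooth_on c P).
Hypotheses (idemP : forall x, P x *m P x = P x)
  (A'E : forall x, cdom c x -> A' x = A x - dz c P x)
  (A'P : forall x, cdom c x -> A' x *m P x = P x *m A x - dz c P x).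

(** Multiplication by [P + mu (1 - P)]. The companion [cogauge] is multiplication by
    [mu P + (1 - P)], which is [mu] times the inverse, so no negative power of [mu] is ever
    needed. *)
Let gauge w : nat -> vecfield := fun q x =>
  P x *m w q x + (1%:M - P x) *m shift_seq w q x.

Let cogauge w : nat -> vecfield := fun q x =>
  P x *m shift_seq w q x + (1%:M - P x) *m w q x.

Let sPc : smooth_on c (fun x => 1%:M - P x).
Proof. by apply: smooth_onB => //; exact: smooth_on_cst. Qed.

Let smooth_cogauge w : smooth_seq w -> smooth_seq (cogauge w).
Proof.
move=> sw q; apply: smooth_onD; last exact: smooth_onM.
by apply: smooth_onM => //; exact: smooth_shift.
Qed.

Let shift_gauge w q x : shift_seq (gauge w) q x =
  P x *m shift_seq w q x + (1%:M - P x) *m shift_seq (shift_seq w) q x.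
Proof. by case: q => [|q] //=; rewrite !mulmx0 addr0. Qed.

Let gauge_cogauge w : eq_seq (gauge (cogauge w)) (shift_seq w).
Proof.
have PPc x : P x *m (1%:M - P x) = 0 by rewrite mulmxBr mulmx1 idemP subrr.
have PcP x : (1%:M - P x) *m P x = 0 by rewrite mulmxBl mul1mx idemP subrr.
have PcPc x : (1%:M - P x) *m (1%:M - P x) = 1%:M - P x.
  by rewrite mulmxBr mulmx1 PcP subr0.
move=> q x _; rewrite /gauge.
have -> : shift_seq (cogauge w) q x =
    P x *m shift_seq (shift_seq w) q x + (1%:M - P x) *m shift_seq w q x.
  by case: q => [|q] //=; rewrite !mulmx0 addr0.
rewrite /cogauge !mulmxDr !mulmxA idemP PPc PcP PcPc !mul0mx addr0 add0r -mulmxDl.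
by rewrite addrC subrK mul1mx.
Qed.

(** Comparing powers of [mu], the intertwining amounts to [A' P = P A - dz P] and
    [A' (1 - P) = (1 - P) A]; the second follows from the two hypotheses on [A']. *)
Let gauge_pencil w : smooth_seq w -> eq_seq (pencil A' (gauge w)) (gauge (pencil A w)).
Proof.
move=> sw q x cx; have ss := smooth_shift sw.
rewrite /gauge (shift_pencil A w q cx) /pencil -/(gauge w) shift_gauge.
have -> : dz c (gauge w q) x = dz c P x *m w q x + P x *m dz c (w q) x
    - dz c P x *m shift_seq w q x + (1%:M - P x) *m dz c (shift_seq w q) x.
  rewrite (dzD (smooth_onM sP (sw q)) (smooth_onM sPc (ss q)) cx).
  rewrite (dzM sP (sw q) cx) (dzM sPc (ss q) cx) (dzB (smooth_on_cst c _) sP cx).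
  by rewrite dz_cst sub0r mulNmx !addrA.
move: (shift_seq w q x) (shift_seq (shift_seq w) q x) (w q x) => b e a.
move: (dz c (w q) x) (dz c (shift_seq w q) x) => a1 b1.
have h1 := A'P cx.
have h2 : A' x *m (1%:M - P x) = (1%:M - P x) *m A x.
  by rewrite mulmxBr mulmx1 h1 {1}A'E // mulmxBl mul1mx opprB addrA subrK.
have [Pc PcE] : exists Pc, Pc = 1%:M - P x by exists (1%:M - P x).
rewrite -PcE in h2 *; rewrite !(mulmxDr, mulmxN, mulmxA) h1 h2 PcE.
rewrite !mulmxBl !mul1mx.
move: (dz c P x *m a) (dz c P x *m b) (P x *m a1) (P x *m b1) => t1 t2 t3 t4.
move: (P x *m A x *m a) (P x *m A x *m b) (P x *m A x *m e) => t5 t6 t7.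
move: (A x *m b) (A x *m e) => t8 t9.
apply/matrixP => i j; rewrite !mxE; ring.
Qed.

(** Since [mu] commutes with the pencil, [mu] times the [N]-th power of the new pencil is [gauge]
    after the [N]-th power of the old one after [cogauge]. The two gauges raise the degree by one
    each, and removing the factor [mu] lowers it by one. *)
Lemma degree_bounded_gauge s : degree_bounded A s -> degree_bounded A' s.+1.
Proof.
move=> bA N d w sw dw q x hq cx.
have gaugeN v : smooth_seq v ->
    eq_seq (iter N (pencil A') (gauge v)) (gauge (iter N (pencil A) v)).
  move=> sv; elim: (N) => [|K IH] t y cy; first by [].
  have sK := smooth_iter_pencil K sA sv.
  transitivity (pencil A' (gauge (iter K (pencil A) v)) t y).
    exact: (eq_pencil (fun _ _ => erefl) IH t cy).
  exact: (gauge_pencil sK t cy).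
have shiftN : eq_seq (shift_seq (iter N (pencil A') w)) (iter N (pencil A') (shift_seq w)).
  elim: (N) => [|K IH] t y cy; first by [].
  transitivity (pencil A' (shift_seq (iter K (pencil A') w)) t y).
    exact: (shift_pencil A' _ t cy).
  exact: (eq_pencil (fun _ _ => erefl) IH t cy).
have dcog : degree_le d.+1 (cogauge w).
  move=> t y ht cy; rewrite /cogauge dw ?mulmx0 ?addr0 //; last by apply: ltn_trans ht.
  by case: t ht => [//|t] ht /=; rewrite dw ?mulmx0.
have scog := smooth_cogauge sw.
have bcog := bA N _ _ scog dcog.
rewrite -[LHS]/(shift_seq (iter N (pencil A') w) q.+1 x) shiftN //.
rewrite -(eq_iter_pencil N (fun x _ => erefl) (@gauge_cogauge w) q.+1 cx).
rewrite (gaugeN _ scog q.+1 x cx) /gauge /= !bcog ?mulmx0 ?addr0 //.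
  by rewrite addSn -addnS.
by rewrite addSn -addnS ltnW.
Qed.

End Gauge.
End Pencil.

(** * Unitons as gauge transformations of the pencil *)

Section Unitons.
Context {R : realType} {M : riemann_surface R} {n : nat} (c : chart M).
Local Notation mxfield := (M -> 'M[R[i]]_n).
Implicit Types (A P Phi alpha : mxfield).

Lemma invmx_left (A B : 'M[R[i]]_n) : B *m A = 1%:M -> invmx A = B.
Proof.
move=> BA; have uA : A \in unitmx by apply: (proj2 (mulmx1_unit BA)).
by rewrite -[LHS]mul1mx -BA -mulmxA mulmxV // mulmx1.
Qed.

Lemma unitary_adjl (A : 'M[R[i]]_n) : A \is unitarymx -> A^t* *m A = 1%:M.
Proof. by move=> /unitarymxP /mulmx1C. Qed.

Let neq2 : (2 : R[i]) != 0. Proof. by rewrite pnatr_eq0. Qed.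

Let mulV2 : (2^-1 * 2 : R[i]) = 1. Proof. exact: mulVf. Qed.

Let half_double (A : 'M[R[i]]_n) : 2^-1 *: (2 *: A) = A.
Proof. by rewrite scalerA mulV2 scale1r. Qed.

Let half_doubleD (A B : 'M[R[i]]_n) : 2^-1 *: (2 *: A + 2 *: B) = A + B.
Proof. by rewrite -scalerDr half_double. Qed.

Lemma cartanE alpha x : cartan alpha x = alpha x + alpha x - 1%:M.
Proof. by rewrite /cartan /perp opprB addrA. Qed.

Lemma cartan_square alpha x : subbundle alpha -> cartan alpha x *m cartan alpha x = 1%:M.
Proof.
move=> sub; have := subbundle_idem sub x; rewrite cartanE; set P := alpha x => PP.
rewrite !(mulmxBl, mulmxBr, mulmxDl, mulmxDr) !mulmx1 !mul1mx PP.
by apply/matrixP => i j; rewrite !mxE; ring.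
Qed.

Lemma cartan_unitary alpha x : subbundle alpha -> cartan alpha x \is unitarymx.
Proof.
move=> sub; apply/unitarymxP.
suff -> : (cartan alpha x)^t* = cartan alpha x by exact: cartan_square.
by rewrite /cartan !ctrmxB (subbundle_herm sub) ctrmx1.
Qed.

Lemma smooth_cartan alpha : subbundle alpha -> smooth_on c (cartan alpha).
Proof.
move=> sub; apply: smooth_onB; first exact: subbundle_smooth.
exact: subbundle_smooth (subbundle_perp sub).
Qed.

Lemma dz_cartan alpha x : subbundle alpha -> cdom c x ->
  dz c (cartan alpha) x = 2 *: dz c alpha x.
Proof.
move=> sub cx; have s := subbundle_smooth c sub.
transitivity (dz c (fun y => 2 *: alpha y - 1%:M) x).
  by apply: (dz_ext cx) => y _; rewrite cartanE scaler_nat mulr2n.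
by rewrite (dzB (smooth_onZ 2 s) (smooth_on_cst c _) cx) (dzZ 2 s cx) dz_cst subr0.
Qed.

Lemma smooth_conn_z Phi : smooth_on c Phi -> (forall x, Phi x \is unitarymx) ->
  smooth_on c (conn_z c Phi).
Proof.
move=> sPhi uPhi.
have s := smooth_onZ 2^-1 (smooth_onM (smooth_on_adj sPhi) (smooth_on_dz sPhi)).
by apply: smooth_on_ext s => x _; rewrite /conn_z (invmx_left (unitary_adjl (uPhi x))).
Qed.

(** This is the z-derivative of the unitarity relation [Phi^t* Phi = 1]. *)
Lemma adj_conn_zbar Phi x : smooth_on c Phi -> (forall x, Phi x \is unitarymx) ->
  cdom c x -> (conn_zbar c Phi x)^t* = - conn_z c Phi x.
Proof.
move=> sPhi uPhi cx; rewrite /conn_zbar /conn_z (invmx_left (unitary_adjl (uPhi x))).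
have E : dz c (fun y => (Phi y)^t* *m Phi y) x = 0.
  rewrite -[RHS](dz_cst c (1%:M : 'M[R[i]]_n) x).
  by apply: (dz_ext cx) => y _; exact: unitary_adjl.
move: E; rewrite (dzM (smooth_on_adj sPhi) sPhi cx) (dz_adj sPhi cx) => /eqP.
rewrite addr_eq0 => /eqP E.
have h : ((Phi x)^t* *m dzbar c Phi x)^t* = - ((Phi x)^t* *m dz c Phi x).
  by rewrite ctrmxM ctrmxK E.
have h2 : Num.conj (2^-1 : R[i]) = 2^-1 by rewrite fmorphV rmorph_nat.
have -> (B : 'M[R[i]]_n) : (2^-1 *: B)^t* = 2^-1 *: B^t*.
  by apply/matrixP => i j; rewrite !mxE -[in RHS]h2 -rmorphM.
by rewrite h scalerN.
Qed.

Section Uniton.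
Variables (Phi alpha : mxfield) (x : M).
Hypotheses (uni : uniton Phi alpha) (cx : cdom c x).

Let sub : subbundle alpha. Proof. by case: uni. Qed.
Let sPhi : smooth_on c Phi. Proof. by case: uni => -[s _ _] _ _ _; exact: s. Qed.
Let uPhi y : Phi y \is unitarymx. Proof. by case: uni => -[_ u _] _ _ _; exact: u. Qed.

(** Projected constant vectors span every fibre, so a closure condition on sections becomes a matrix
    identity. *)
Let const_section (v : 'cV[R[i]]_n) : section_on c alpha (fun y => alpha y *m v).
Proof.
split; first exact: (smooth_onM (subbundle_smooth c sub) (smooth_on_cst c v)).
by move=> y _; rewrite /fibre mulmxA (subbundle_idem sub).
Qed.

Lemma uniton_conn_z : alpha x *m (conn_z c Phi x *m alpha x) = conn_z c Phi x *m alpha x.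
Proof.
case: uni => _ _ _ h; apply/eqP; rewrite -subr_eq0; apply/eqP; apply: mx_eq0_vec => v.
have [_ /(_ x cx)] := h c _ (const_section v).
by rewrite /fibre mulmxBl !mulmxA => ->; rewrite subrr.
Qed.

(** The zbar-condition on a uniton says that [dzbar alpha + A_zbar alpha] takes values in [alpha].
    Its adjoint is an equation in z only, which [uniton_conn_z] simplifies. *)
Lemma uniton_dz : alpha x *m dz c alpha x =
  alpha x *m conn_z c Phi x - conn_z c Phi x *m alpha x.
Proof.
have sa := subbundle_smooth c sub.
have E : perp alpha x *m (dzbar c alpha x + conn_zbar c Phi x *m alpha x) = 0.
  case: uni => _ _ h _; apply: mx_eq0_vec => v.
  have [_ /(_ x cx)] := h c _ (const_section v).
  rewrite (dzbarM sa (smooth_on_cst c v) cx) dzbar_cst mulmx0 addr0.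
  rewrite mulmxA -mulmxDl /fibre mulmxBl mul1mx mulmxBl => e.
  by rewrite -[X in _ - X]mulmxA e subrr.
have := congr1 (fun X => X^t*) E.
rewrite ctrmxM ctrmx0 raddfD map_mxD /= ctrmxM (adj_conn_zbar sPhi uPhi cx).
rewrite -(adj_dz sub cx) ctrmxK (subbundle_herm sub) (subbundle_herm (subbundle_perp sub)).
rewrite mulmxBr mulmx1 mulmxDl mulmxN mulNmx -(mulmxA (alpha x)) uniton_conn_z.
have d : dz c alpha x = dz c alpha x *m alpha x + alpha x *m dz c alpha x.
  by rewrite (dz_idem sub cx).
rewrite {1}d => e.
have -> : alpha x *m dz c alpha x = (dz c alpha x *m alpha x + alpha x *m dz c alpha x -
    alpha x *m conn_z c Phi x - (dz c alpha x *m alpha x - conn_z c Phi x *m alpha x)) +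
    (alpha x *m conn_z c Phi x - conn_z c Phi x *m alpha x).
  by apply/matrixP => i j; rewrite !mxE; ring.
by rewrite e add0r.
Qed.

(** The product rule gives the conjugate of the old [conn_z] by the Cartan factor plus that factor
    times [dz alpha]; the two uniton identities collapse the sum. *)
Lemma conn_z_uniton : conn_z c (fun y => Phi y *m cartan alpha y) x =
  conn_z c Phi x - dz c alpha x.
Proof.
have uu := unitary_adjl (uPhi x).
have inv : invmx (Phi x *m cartan alpha x) = cartan alpha x *m invmx (Phi x).
  apply: invmx_left; rewrite (invmx_left uu) mulmxA -(mulmxA (cartan alpha x)) uu mulmx1.
  exact: cartan_square.
rewrite {1}/conn_z inv (dzM sPhi (smooth_cartan sub) cx) (dz_cartan sub cx) mulmxDr.
have -> : cartan alpha x *m invmx (Phi x) *m (Phi x *m (2 *: dz c alpha x)) =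
    2 *: (cartan alpha x *m dz c alpha x).
  by rewrite (invmx_left uu) !mulmxA -(mulmxA _ _ (Phi x)) uu mulmx1 -scalemxAr.
have -> : cartan alpha x *m invmx (Phi x) *m (dz c Phi x *m cartan alpha x) =
    2 *: (cartan alpha x *m conn_z c Phi x *m cartan alpha x).
  rewrite /conn_z -scalemxAr -scalemxAl scalerA mulfV // scale1r.
  by rewrite !mulmxA.
rewrite half_doubleD !cartanE.
have h1 := uniton_conn_z; have h2 := uniton_dz.
move: h1 h2; rewrite mulmxA.
move: (conn_z c Phi x) (alpha x) (dz c alpha x) => B P D h1 h2.
rewrite !(mulmxBl, mulmxBr, mulmxDl, mulmxDr, mulNmx, mulmxN) !mulmx1 !mul1mx h1 h2.
move: (B *m P) (P *m B) => X Y.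
by apply/matrixP => i j; rewrite !mxE; ring.
Qed.

End Uniton.

Lemma uniton_product_bounded (Q : 'M[R[i]]_n) (alpha : nat -> mxfield) s :
  Q \is unitarymx ->
  (forall i, (i < s)%N -> uniton (uniton_product Q alpha i) (alpha i)) ->
  [/\ smooth_on c (uniton_product Q alpha s),
      forall x, uniton_product Q alpha s x \is unitarymx
    & degree_bounded c (conn_z c (uniton_product Q alpha s)) s].
Proof.
move=> uQ; elim: s => [|s IH] uni.
  have E : uniton_product Q alpha 0 = fun=> Q.
    by apply/funext => x; rewrite /uniton_product big_ord0 mulr1.
  rewrite E; split; [exact: smooth_on_cst|by []|].
  apply: degree_bounded_ext (@degree_bounded0 R M n c) => x _.
  by rewrite /conn_z dz_cst mulmx0 scaler0.
have [sPhi uPhi bPhi] := IH (fun i h => uni i (ltnW h)).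
have us := uni s (ltnSn s).
have sub : subbundle (alpha s) by case: us.
have E : uniton_product Q alpha s.+1 =
    fun x => uniton_product Q alpha s x *m cartan (alpha s) x.
  by apply/funext => x; rewrite /uniton_product big_ord_recr /= mulrA.
have sE : smooth_on c (uniton_product Q alpha s.+1).
  by rewrite E; apply: smooth_onM sPhi (smooth_cartan sub).
have uE x : uniton_product Q alpha s.+1 x \is unitarymx.
  by rewrite E; exact: mul_unitarymx (uPhi x) (cartan_unitary x sub).
split; [exact: sE|exact: uE|].
apply: (@degree_bounded_gauge _ _ _ c (conn_z c (uniton_product Q alpha s)) _ (alpha s)) bPhi.
- exact: smooth_conn_z sPhi uPhi.
- exact: subbundle_smooth.
- exact: subbundle_idem.
- by move=> x cx; rewrite E (conn_z_uniton us cx).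
move=> x cx; rewrite E (conn_z_uniton us cx) mulmxBl.
have d := dz_idem sub cx; have h := uniton_dz us cx.
have -> : dz c (alpha s) x *m alpha s x = dz c (alpha s) x - alpha s x *m dz c (alpha s) x.
  by rewrite -[X in _ = X - _]d addrK.
by rewrite h; apply/matrixP => i j; rewrite !mxE; ring.
Qed.

(** Here [- phi dz phi] and [perp phi dz phi] are the blocks of [d_z] entering and leaving [phi]; so
    [conn_z] is minus the off-diagonal part of [d_z]. *)
Lemma conn_z_cartan (phi : mxfield) x : subbundle phi -> cdom c x ->
  conn_z c (cartan phi) x = phi x *m dz c phi x - perp phi x *m dz c phi x.
Proof.
move=> sub cx; rewrite /conn_z (invmx_left (cartan_square x sub)) (dz_cartan sub cx).
by rewrite -scalemxAr half_double /cartan mulmxBl.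
Qed.

End Unitons.

(** * Counting paths *)

Section ReturnPaths.
Context {R : realType} {M : riemann_surface R} {n : nat} (c : chart M).
Local Notation mxfield := (M -> 'M[R[i]]_n).
Variables (phi : mxfield) (G : nat -> mxfield) (r p : nat) (v : M -> 'cV[R[i]]_n).
(** [U N j] stands for the coefficient of [mu ^ (2 j)] in the [N]-th power of the conjugated pencil
    applied to [v]: [N] counts derivatives, [j] turns. *)
Variable U : nat -> nat -> M -> 'cV[R[i]]_n.

Local Notation Rm := (remainder G r).
Local Notation K i := (second_ff (G i) (perp (G i)) c).
Local Notation b := (second_ff (G r) phi c).
Local Notation g := (second_ff (G r) Rm c).
Local Notation h := (second_ff Rm phi c).
Local Notation C := (first_return phi G r c).
Local Notation E := (second_return phi G r c).

Hypotheses (G0 : G 0%N = phi) (p_gt0 : (0 < p)%N).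
Hypotheses (phi_idem : forall x, phi x *m phi x = phi x).
Hypotheses (U00 : forall x, cdom c x -> U 0 0 x = v x)
  (U0S : forall j x, cdom c x -> U 0 j.+1 x = 0)
  (phiv : forall x, cdom c x -> phi x *m v x = v x)
  (Gphi : forall i x, (i < r)%N -> cdom c x -> G i.+1 x *m phi x = 0)
  (Rphi : forall x, cdom c x -> Rm x *m phi x = 0).
(** Each derivative either acts inside a summand or follows one arrow; only the arrows [b] and [h],
    which end in [phi], raise [j]. *)
Hypotheses
  (U_phiS : forall N j x, cdom c x ->
    phi x *m U N.+1 j.+1 x = phi x *m dz c (fun y => phi y *m U N j.+1 y) x +
      (b x *m (G r x *m U N j x) + h x *m (Rm x *m U N j x)))
  (U_gauss : forall N j i x, (i < r)%N -> cdom c x ->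
    G i.+1 x *m U N.+1 j x = G i.+1 x *m dz c (fun y => G i.+1 y *m U N j y) x +
      K i x *m (G i x *m U N j x))
  (U_rem : forall N j x, cdom c x ->
    Rm x *m U N.+1 j x = Rm x *m dz c (fun y => Rm y *m U N j y) x +
      g x *m (G r x *m U N j x)).
Hypotheses (Cv : forall x, cdom c x -> C x *m v x = 0)
  (Cb : forall x, cdom c x -> C x ^+ p.-1 *m b x = 0)
  (Cp : forall x, cdom c x -> C x ^+ p = 0).

Let dz0 (Z : M -> 'cV[R[i]]_n) x : (forall y, cdom c y -> Z y = 0) -> cdom c x ->
  dz c Z x = 0.
Proof. by move=> Z0 cx; rewrite -[RHS](dz_cst c (0 : 'cV[R[i]]_n) x); exact: dz_ext. Qed.

(* One turn of the cycle takes at least r + 1 derivatives. *)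
Lemma path_too_short N j : (forall i, (i <= r)%N -> (N < j * r.+1 + i)%N ->
    forall x, cdom c x -> G i x *m U N j x = 0) /\
  ((N <= j * r.+1 + r)%N -> forall x, cdom c x -> Rm x *m U N j x = 0).
Proof.
elim: N j => [|N IH] j.
  case: j => [|j]; last by split=> [i _ _|_] x cx; rewrite U0S // mulmx0.
  split=> [[//|i] ir _|_] x cx; rewrite U00 // -phiv // mulmxA.
    by rewrite Gphi // mul0mx.
  by rewrite Rphi // mul0mx.
split=> [[|i] ir ht x cx|ht x cx].
- case: j ht => [//|j]; rewrite mulSn => ht.
  rewrite G0 U_phiS // dz0 ?mulmx0 ?add0r //; last first.
    move=> y cy; rewrite -G0; have [h1 _] := IH j.+1; apply: h1 => //.
    by rewrite mulSn; lia.
  have [h1 h2] := IH j; rewrite h1 //; last by lia.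
  by rewrite h2 ?mulmx0 ?addr0 //; lia.
- have [h1 _] := IH j.
  rewrite U_gauss // dz0 // => [|y cy]; last by apply: h1 => //; lia.
  by rewrite h1 ?mulmx0 ?addr0 //; [exact: ltnW|lia].
have [h1 h2] := IH j.
rewrite U_rem // dz0 // => [|y cy]; last by apply: h2 => //; lia.
by rewrite h1 ?mulmx0 ?addr0 //; lia.
Qed.

Let chain_phi i x : gauss_chain G i c x *m phi x = gauss_chain G i c x.
Proof. by elim: i => [|i IH] /=; [rewrite G0|rewrite -mulmxA IH]. Qed.

Let CE x : C x = b x *m gauss_chain G r c x. Proof. by []. Qed.
Let EE x : E x = h x *m (g x *m gauss_chain G r c x). Proof. by rewrite mulmxA. Qed.

Let exprS_mx (A : 'M[R[i]]_n) k : A ^+ k.+1 = A *m A ^+ k. Proof. exact: exprS. Qed.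
Let exprD_mx (A : 'M[R[i]]_n) k l : A ^+ (k + l) = A ^+ k *m A ^+ l.
Proof. exact: exprD. Qed.

(* The index N = j (r + 1) + i + t of U stands for j turns, i further steps along
   the chain and t derivatives in excess. *)
Record paths_of_excess (t : nat) : Prop := PathsOfExcess {
  (* [t * p < j + p] means [(t - 1) * p < j] without truncated subtraction. So many turns cannot be
     made with excess [t - 1], hence the last [i] steps are all arrows. *)
  excess_gauss : forall i j, (t * p < j + p)%N -> (i <= r)%N -> forall x, cdom c x ->
    G i x *m U (j * r.+1 + i + t) j x = gauss_chain G i c x *m U (j * r.+1 + t) j x;
  excess_main : forall x, cdom c x ->
    phi x *m U (t * p * r.+1 + t) (t * p) x = (C x ^+ p.-1 *m E x) ^+ t *m v x;
  excess_vanish : forall j, (t * p < j)%N -> forall x, cdom c x ->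
    phi x *m U (j * r.+1 + t) j x = 0;
  excess_rem : forall j, (t * p < j + p)%N -> forall x, cdom c x ->
    Rm x *m U (j * r.+1 + r + t) j x = 0 }.

(** Without excess every turn is a turn through [c], and the first one already kills [v]. *)
Lemma paths_of_excess0 : paths_of_excess 0.
Proof.
have short i j x : (i < r)%N -> cdom c x -> G i.+1 x *m U (j * r.+1 + i) j x = 0.
  by move=> ir cx; have [h1 _] := path_too_short (j * r.+1 + i) j; apply: h1 => //; lia.
have gaussA i j : (i <= r)%N -> forall x, cdom c x ->
    G i x *m U (j * r.+1 + i) j x = gauss_chain G i c x *m U (j * r.+1) j x.
  elim: i => [|i IH] ir x cx /=; first by rewrite addn0.
  rewrite addnS U_gauss // dz0 ?mulmx0 ?add0r // => [|y cy]; last exact: short.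
  by rewrite IH ?mulmxA // ltnW.
have rem j x : cdom c x -> Rm x *m U (j * r.+1 + r) j x = 0.
  by move=> cx; have [_ h2] := path_too_short (j * r.+1 + r) j; exact: h2.
split.
- by move=> i j _ ir x cx; rewrite !addn0; exact: gaussA.
- by move=> x cx; rewrite mul0n /= U00 // phiv // expr0 mul1mx.
- move=> j; rewrite mul0n => j0 x cx; rewrite addn0.
  elim: j j0 => [//|j IH] _.
  have -> : (j.+1 * r.+1 = (j * r.+1 + r).+1)%N by rewrite mulSn; lia.
  rewrite U_phiS // dz0 ?mulmx0 ?add0r // => [|y cy]; last first.
    have [h1 _] := path_too_short (j * r.+1 + r) j.+1.
    by rewrite -G0; apply: h1 => //; rewrite mulSn; lia.
  rewrite rem // mulmx0 addr0 gaussA // mulmxA -CE.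
  case: j IH => [|j] IH; first by rewrite mul0n U00 // Cv.
  by rewrite CE -chain_phi mulmxA -mulmxA IH // mulmx0.
by move=> j _ x cx; rewrite addn0; exact: rem.
Qed.

(** More than [t * p] turns are impossible with excess [t], so the additional derivative is spent by
    turn [t * p + 1], and all later turns go through [c]. As [c ^ p = 0], at most [p] turns are
    gained; when exactly [p] are gained, [c ^ p.-1] kills what came through [b] and leaves [e]. *)
Lemma paths_of_excessS t : paths_of_excess t -> paths_of_excess t.+1.
Proof.
move=> [hA hB hC hD].
have chain0 i j x : (t * p < j)%N -> cdom c x ->
    gauss_chain G i c x *m U (j * r.+1 + t) j x = 0.
  by move=> tj cx; rewrite -chain_phi -mulmxA hC // mulmx0.
have gauss0 i j x : (t * p < j)%N -> (i <= r)%N -> cdom c x ->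
    G i x *m U (j * r.+1 + i + t) j x = 0.
  by move=> tj ir cx; rewrite hA ?chain0 //; lia.
have gaussA i j : (t * p < j)%N -> (i <= r)%N -> forall x, cdom c x ->
    G i x *m U (j * r.+1 + i + t.+1) j x = gauss_chain G i c x *m U (j * r.+1 + t.+1) j x.
  move=> tj; elim: i => [|i IH] ir x cx /=; first by rewrite addn0.
  have -> : (j * r.+1 + i.+1 + t.+1 = (j * r.+1 + i.+1 + t).+1)%N by lia.
  rewrite U_gauss // dz0 ?mulmx0 ?add0r // => [|y cy]; last exact: gauss0.
  have -> : (j * r.+1 + i.+1 + t = j * r.+1 + i + t.+1)%N by lia.
  by rewrite IH ?mulmxA // ltnW.
(* A visit to the remainder uses up one unit of excess: it is entered from [G r] by a path of excess
   [t]. *)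
have remE j x : (t * p < j + p)%N -> cdom c x ->
    Rm x *m U (j * r.+1 + r + t.+1) j x = g x *m (gauss_chain G r c x *m U (j * r.+1 + t) j x).
  move=> tj cx; rewrite addnS (U_rem _ _ cx) dz0 ?mulmx0 ?add0r; [|exact: hD|exact: cx].
  by rewrite hA.
have phiE j x : (t * p < j.+1)%N -> cdom c x ->
    phi x *m U (j.+1 * r.+1 + t.+1) j.+1 x =
    b x *m (G r x *m U (j * r.+1 + r + t.+1) j x) +
    h x *m (Rm x *m U (j * r.+1 + r + t.+1) j x).
  move=> tj cx.
  have -> : (j.+1 * r.+1 + t.+1 = (j * r.+1 + r + t.+1).+1)%N by rewrite mulSn; lia.
  rewrite U_phiS // dz0 ?mulmx0 ?add0r // => y cy.
  have -> : (j * r.+1 + r + t.+1 = j.+1 * r.+1 + t)%N by rewrite mulSn; lia.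
  exact: hC.
pose q := (t * p)%N.
(* Turn [q + 1] closes through [b], with a value that need not be computed, or through [h], where
   the main term of excess [t] appears; then [k] turns through [c] follow. *)
have powers k x : cdom c x ->
    phi x *m U ((q + k).+1 * r.+1 + t.+1) (q + k).+1 x =
    C x ^+ k *m (b x *m (G r x *m U (q * r.+1 + r + t.+1) q x) +
      E x *m ((C x ^+ p.-1 *m E x) ^+ t *m v x)).
  move=> cx; elim: k => [|k IH].
    rewrite addn0 expr0 mul1mx phiE ?remE ?/q; [|lia|by []|lia|by []].
    rewrite -(hB x cx) EE -!(mulmxA (h x)) -(mulmxA (g x)).
    by rewrite (mulmxA (gauss_chain _ _ _ _) (phi x)) chain_phi.
  rewrite (addnS q k) phiE; [|rewrite /q; lia|by []].
  rewrite gaussA; [|rewrite /q; lia|by []|by []].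
  rewrite remE; [|rewrite /q; lia|by []].
  rewrite chain0; [|rewrite /q; lia|by []].
  rewrite !mulmx0 addr0 mulmxA -CE exprS_mx -mulmxA -IH.
  by rewrite CE -[in LHS]chain_phi !mulmxA.
have Ck k x : cdom c x -> (p <= k)%N -> C x ^+ k = 0.
  by move=> cx pk; rewrite -(subnK pk) exprD_mx Cp // mulmx0.
split.
- by move=> i j; rewrite mulSn => tj ir x cx; apply: gaussA => //; lia.
- move=> x cx.
  have -> : (t.+1 * p = (q + p.-1).+1)%N by rewrite mulSn /q; lia.
  rewrite (powers p.-1 x cx) mulmxDr (mulmxA (C x ^+ p.-1)) (Cb cx) mul0mx add0r.
  by rewrite exprS_mx -!mulmxA.
- move=> j; rewrite mulSn => tj x cx.
  have -> : j = (q + (j - q.+1)).+1 by rewrite /q; lia.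
  by rewrite powers // Ck ?mul0mx // /q; lia.
move=> j; rewrite mulSn => tj x cx; rewrite remE //; last by lia.
by rewrite chain0 ?mulmx0 //; lia.
Qed.

Lemma return_paths t x : cdom c x ->
  phi x *m U (t * p * r.+1 + t) (t * p) x = (C x ^+ p.-1 *m E x) ^+ t *m v x.
Proof.
move=> cx; have [_ h _ _] : paths_of_excess t; last exact: h.
by elim: t => [|t IH]; [exact: paths_of_excess0|exact: paths_of_excessS].
Qed.

End ReturnPaths.

(** * The pencil of phi, separated by parity in the spectral parameter *)

Section Parity.
Context {R : realType} {M : riemann_surface R} {n : nat} (c : chart M).
Local Notation mxfield := (M -> 'M[R[i]]_n).
Variables (phi : mxfield) (phi_sub : subbundle phi).
Implicit Types (w : nat -> M -> 'cV[R[i]]_n) (x : M).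

Let A := conn_z c (cartan phi).

Let smooth_phi : smooth_on c phi := subbundle_smooth c phi_sub.

Let der x : cdom c x ->
  [/\ dz c phi x *m phi x = perp phi x *m dz c phi x,
      dz c phi x *m perp phi x = phi x *m dz c phi x
    & phi x *m dz c phi x *m phi x = 0].
Proof. by move=> cx; exact: (idem_der (subbundle_idem phi_sub x) (dz_idem phi_sub cx)). Qed.

(** Every passage between [phi] and its complement carries one factor [mu], so a series that starts
    in [phi] keeps this form. *)
Definition parity_alternating w := forall j x, cdom c x ->
  phi x *m w j.*2 x = w j.*2 x /\ phi x *m w j.*2.+1 x = 0.

Lemma smooth_conn_cartan : smooth_on c A.
Proof.
apply: smooth_conn_z; first exact: smooth_cartan.
by move=> x; exact: cartan_unitary.
Qed.

Let A_in x (a : 'cV[R[i]]_n) : cdom c x -> phi x *m a = a -> A x *m a = - (dz c phi x *m a).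
Proof.
move=> cx pa; have [e _ z] := der cx.
rewrite /A (conn_z_cartan phi_sub cx) mulmxBl -{1}pa mulmxA z mul0mx sub0r -e.
by rewrite -mulmxA pa.
Qed.

Let A_out x (a : 'cV[R[i]]_n) : cdom c x -> phi x *m a = 0 -> A x *m a = dz c phi x *m a.
Proof.
move=> cx pa; have [e e' _] := der cx.
have qa : perp phi x *m a = a by rewrite mulmxBl mul1mx pa subr0.
rewrite /A (conn_z_cartan phi_sub cx) mulmxBl -e -[dz c phi x *m phi x *m a]mulmxA pa mulmx0 subr0 -e'.
by rewrite -mulmxA qa.
Qed.

Let D_out x (a : 'cV[R[i]]_n) : cdom c x -> phi x *m a = 0 ->
  phi x *m (dz c phi x *m a) = dz c phi x *m a.
Proof.
move=> cx pa; have [_ e' _] := der cx.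
have qa : perp phi x *m a = a by rewrite mulmxBl mul1mx pa subr0.
by rewrite mulmxA -e' -mulmxA qa.
Qed.

Let D_in x (a : 'cV[R[i]]_n) : cdom c x -> phi x *m a = a ->
  phi x *m (dz c phi x *m a) = 0.
Proof. by move=> cx pa; have [_ _ z] := der cx; rewrite -{1}pa !mulmxA z mul0mx. Qed.

Let dz_in (a : M -> 'cV[R[i]]_n) x : smooth_on c a ->
  (forall y, cdom c y -> phi y *m a y = a y) -> cdom c x ->
  dz c a x = dz c phi x *m a x + phi x *m dz c a x.
Proof.
move=> sa pa cx; rewrite -(dzM smooth_phi sa cx).
by apply: (dz_ext cx) => y cy; rewrite pa.
Qed.

Let dz_out (a : M -> 'cV[R[i]]_n) x : smooth_on c a ->
  (forall y, cdom c y -> phi y *m a y = 0) -> cdom c x ->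
  phi x *m dz c a x = - (dz c phi x *m a x).
Proof.
move=> sa pa cx; apply/eqP; rewrite -addr_eq0 addrC -(dzM smooth_phi sa cx); apply/eqP.
by rewrite -[RHS](dz_cst c (0 : 'cV[R[i]]_n) x); apply: (dz_ext cx).
Qed.

Let shift_odd w j x : parity_alternating w -> cdom c x -> phi x *m shift_seq w j.*2 x = 0.
Proof. by move=> alt cx; case: j => [|j]; [rewrite mulmx0|case: (alt j x cx)]. Qed.

(** The term [A] cancels the off-diagonal part of [d_z], and [- mu A] restores it with a factor
    [mu]. *)
Lemma pencil_even w j x : smooth_seq c w -> parity_alternating w -> cdom c x ->
  pencil c A w j.*2 x =
  phi x *m dz c (w j.*2) x - dz c phi x *m shift_seq w j.*2 x.
Proof.
move=> sw alt cx; have [pa _] := alt j x cx.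
rewrite /pencil (A_in cx pa) (A_out cx (shift_odd j alt cx)).
rewrite (dz_in (sw _) _ cx); last by move=> y cy; case: (alt j y cy).
congr (_ - _); rewrite addrAC subrr add0r mulmxDr (D_in cx pa) add0r.
by rewrite mulmxA (subbundle_idem phi_sub).
Qed.

Lemma pencil_odd w j x : smooth_seq c w -> parity_alternating w -> cdom c x ->
  pencil c A w j.*2.+1 x =
  dz c (w j.*2.+1) x - phi x *m dz c (w j.*2.+1) x + dz c phi x *m w j.*2 x.
Proof.
move=> sw alt cx; have [pa pb] := alt j x cx.
rewrite /pencil /= (A_in cx pa) (A_out cx pb) opprK.
by rewrite (dz_out (sw _) _ cx) ?opprK // => y cy; case: (alt j y cy).
Qed.

Lemma parity_pencil w : smooth_seq c w -> parity_alternating w -> parity_alternating (pencil c A w).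
Proof.
move=> sw alt j x cx; have [pa pb] := alt j x cx.
rewrite pencil_even // pencil_odd //; split.
  rewrite mulmxBr (mulmxA (phi x) (phi x)) (subbundle_idem phi_sub).
  by rewrite (D_out cx (shift_odd j alt cx)).
rewrite mulmxDr mulmxBr (mulmxA (phi x) (phi x)) (subbundle_idem phi_sub).
by rewrite subrr add0r (D_in cx pa).
Qed.

(* The even coefficients lie in phi and the odd ones in its complement, so pairing
   them conjugates the pencil by (phi + mu phi^perp): d_z then carries the
   parameter mu^2 only on its component from phi^perp to phi. *)
Definition pair_coef w j x := w j.*2 x + w j.*2.+1 x.

Lemma phi_pair_coef w j x : parity_alternating w -> cdom c x ->
  phi x *m pair_coef w j x = w j.*2 x.
Proof. by move=> alt cx; have [pa pb] := alt j x cx; rewrite mulmxDr pa pb addr0. Qed.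

Lemma smooth_pair_coef w j : smooth_seq c w -> smooth_on c (pair_coef w j).
Proof. by move=> sw; exact: smooth_onD. Qed.

Section Step.
Variables (w : nat -> M -> 'cV[R[i]]_n) (x : M).
Hypotheses (sw : smooth_seq c w) (alt : parity_alternating w) (cx : cdom c x).

(** The index rises only along the block [- phi dz phi], which enters [phi] from its complement and
    takes an odd coefficient to the next even one. *)
Lemma pair_coefS j : phi x *m pair_coef (pencil c A w) j.+1 x =
  phi x *m dz c (fun y => phi y *m pair_coef w j.+1 y) x -
  phi x *m dz c phi x *m pair_coef w j x.
Proof.
rewrite (phi_pair_coef j.+1 (parity_pencil sw alt) cx) (pencil_even j.+1 sw alt cx).
have [pa pb] := @alt j x cx.
have -> : phi x *m dz c phi x *m pair_coef w j x = dz c phi x *m shift_seq w j.+1.*2 x.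
  rewrite -mulmxA mulmxDr mulmxDr (D_in cx pa) add0r; exact: D_out cx pb.
have e : dz c (fun y => phi y *m pair_coef w j.+1 y) x = dz c (w j.+1.*2) x.
  by apply: (dz_ext cx) => y cy; rewrite phi_pair_coef.
by rewrite e.
Qed.

(** Towards the complement of [phi] the index is unchanged and the pencil acts as plain [d_z]. The
    matrix [X] will be [G i.+1] or the remainder. *)
Lemma pair_coef_perp (X : 'M[R[i]]_n) j : X *m phi x = 0 ->
  X *m pair_coef (pencil c A w) j x = X *m dz c (pair_coef w j) x.
Proof.
move=> Xp; have [pa pb] := @alt j x cx.
have Xphi (a : 'cV[R[i]]_n) : X *m (phi x *m a) = 0 by rewrite mulmxA Xp mul0mx.
rewrite /pair_coef mulmxDr (pencil_even j sw alt cx) (pencil_odd j sw alt cx).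
rewrite -(D_out cx (shift_odd j alt cx)) mulmxBr !Xphi subrr add0r.
have e1 : X *m dz c (w j.*2) x = X *m (dz c phi x *m w j.*2 x).
  have pay y (cy : cdom c y) : phi y *m w j.*2 y = w j.*2 y by case: (@alt j y cy).
  by rewrite {1}(dz_in (@sw _) pay cx) mulmxDr Xphi addr0.
have e2 : dz c (pair_coef w j) x = dz c (w j.*2) x + dz c (w j.*2.+1) x.
  exact: dzD (@sw _) (@sw _) cx.
by rewrite e2 [in RHS]mulmxDr e1 mulmxDr mulmxBr Xphi subr0 addrC.
Qed.

End Step.

End Parity.

(** * Algebra of the first return map *)

Section ReturnMaps.
Context {R : realType} {M : riemann_surface R} {n : nat} (c : chart M).
Local Notation mxfield := (M -> 'M[R[i]]_n).
Variables (phi : mxfield) (G : nat -> mxfield) (r : nat).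
Hypotheses (phi_sub : subbundle phi) (G_phi : gauss_bundles phi G).

Let subG i : subbundle (G i) := gauss_sub phi_sub G_phi i.

Lemma second_ff_idr (psi chi : mxfield) x : subbundle psi ->
  second_ff psi chi c x *m psi x = second_ff psi chi c x.
Proof. by move=> sub; rewrite /second_ff -mulmxA (subbundle_idem sub). Qed.

Lemma smooth_gauss_chain i : smooth_on c (gauss_chain G i c).
Proof.
elim: i => [|i IH] /=; first exact: subbundle_smooth.
exact: smooth_onM (smooth_second_ff c (subG i) (subbundle_perp (subG i))) IH.
Qed.

Lemma smooth_first_return : smooth_on c (first_return phi G r c).
Proof. exact: smooth_onM (smooth_second_ff c (subG r) phi_sub) (smooth_gauss_chain r). Qed.

Lemma smooth_expr (A : mxfield) k : smooth_on c A -> smooth_on c (fun x => A x ^+ k).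
Proof.
move=> sA; elim: k => [|k IH]; first exact: smooth_on_cst.
by apply: smooth_on_ext (smooth_onM sA IH) => x _; rewrite exprS.
Qed.

(* At generic points the chain maps phi onto G i. *)
Lemma gauss_chain_kill i (X : mxfield) : smooth_on c X ->
  (forall x, cdom c x -> X x *m gauss_chain G i c x = 0) ->
  forall x, cdom c x -> X x *m G i x = 0.
Proof.
elim: i X => [//|i IH] X sX XG x cx.
have [_ imG] := G_phi.
apply: (gauss_kill (subG i) (imG i) sX _ cx) => y cy.
rewrite -(second_ff_perp (subG i) cy) -(second_ff_idr _ _ (subG i)) mulmxA.
have sK := smooth_second_ff c (subG i) (subbundle_perp (subG i)).
apply: (IH (fun y => X y *m second_ff (G i) (perp (G i)) c y)) cy => [|z cz].
  exact: smooth_onM.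
by rewrite -mulmxA XG.
Qed.

Lemma first_return_phi x : first_return phi G r c x *m phi x = first_return phi G r c x.
Proof.
rewrite /first_return -mulmxA; congr (_ *m _).
elim: r => [|i IH] /=; last by rewrite -mulmxA IH.
by rewrite (gauss0 G_phi) (subbundle_idem phi_sub).
Qed.

(** A positive power of [c] factors through [phi] on the right, so vanishing on [phi] is vanishing
    as a matrix. *)
Lemma first_return_pow p x : (0 < p)%N ->
  zero_on phi (bpow (first_return phi G r) p) -> cdom c x ->
  first_return phi G r c x ^+ p = 0.
Proof.
case: p => [//|p] _ Cp cx; apply: mx_eq0_vec => v.
have e : first_return phi G r c x ^+ p.+1 *m phi x = first_return phi G r c x ^+ p.+1.
  have -> : first_return phi G r c x ^+ p.+1 =
      first_return phi G r c x ^+ p *m first_return phi G r c x by exact: exprSr.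
  by rewrite -mulmxA first_return_phi.
rewrite -e -mulmxA; apply: Cp => //.
by rewrite /fibre mulmxA (subbundle_idem phi_sub).
Qed.

(** [c ^ p] is [c ^ p.-1 b] after the chain from [phi] to [G r], and generically that chain is onto
    [G r]. *)
Lemma first_return_pow_last p x : (0 < p)%N ->
  zero_on phi (bpow (first_return phi G r) p) -> cdom c x ->
  first_return phi G r c x ^+ p.-1 *m second_ff (G r) phi c x = 0.
Proof.
move=> p0 Cp cx; rewrite -(second_ff_idr _ _ (subG r)) mulmxA.
have sC := smooth_expr p.-1 smooth_first_return.
have sb := smooth_second_ff c (subG r) phi_sub.
apply: (gauss_chain_kill (X := fun y => first_return phi G r c y ^+ p.-1 *m
  second_ff (G r) phi c y)) cx => [|y cy]; first exact: smooth_onM.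
have := first_return_pow p0 Cp cy; rewrite -{1}(prednK p0) => e.
by rewrite -mulmxA; rewrite -[LHS]exprSr.
Qed.

End ReturnMaps.

(** * Nilpotency from the degree bound *)

Theorem proposition2p22 (R : realType) (M : riemann_surface R)
  (M_connected : connected [set: M]) (n k : nat)
  (phi : M -> 'M[R[i]]_n) (G : nat -> M -> 'M[R[i]]_n) (r p : nat)
  (alpha Imc Kerc : M -> 'M[R[i]]_n)
  (phi_map : grassmann_map k phi)
  (phi_harmonic : harmonic_grassmann phi)
  (phi_uniton : finite_uniton_number (cartan phi))
  (G_phi : gauss_bundles phi G)
  (phi_isotropy : isotropy_order phi G r)
  (p_ge2 : (2 <= p)%N)
  (c_nilorder : nilorder phi (first_return phi G r) p)
  (alpha_hol : holomorphic_subbundle phi alpha)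
  (Imc_def : filled_image phi (bpow (first_return phi G r) p.-1) Imc)
  (Kerc_def : filled_kernel phi (first_return phi G r) Kerc)
  (Imc_alpha : bsub Imc alpha)
  (alpha_Kerc : bsub alpha Kerc) :
  nilpotent_on alpha
    (fun c x => bpow (first_return phi G r) p.-1 c x *m second_return phi G r c x).
Proof.
have phi_sub : subbundle phi by case: phi_map.
have [r0 G_iso _] := phi_isotropy.
have [Cp _] := c_nilorder.
have p0 : (0 < p)%N by apply: ltnW.
have [alpha_sub alpha_phi _] := alpha_hol.
have [Q [s [beta [uQ uni phiE]]]] := phi_uniton.
(* [s] is the number of unitons, so one exponent serves all charts and points. *)
exists s.+1 => c x v cx alphav; rewrite /bpow.
have cartanE' : cartan phi = uniton_product Q beta s by apply/funext.
have [_ _ bounded] := uniton_product_bounded c uQ uni.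
rewrite -cartanE' in bounded.
pose A := conn_z c (cartan phi).
(* The recurrences differentiate, so the vector at [x] is extended to a section of [alpha], which
   lies in [phi] and in the kernel of [c] over the whole chart. *)
pose v0 := fun y => alpha y *m v.
pose w0 := fun q : nat => if q is 0 then v0 else (fun=> 0 : 'cV[R[i]]_n).
have sv0 : smooth_on c v0 := smooth_onM (subbundle_smooth c alpha_sub) (smooth_on_cst c v).
have fv0 y : fibre alpha y (v0 y) by rewrite /fibre mulmxA (subbundle_idem alpha_sub).
have sw0 : smooth_seq c w0 by case=> [|q]; [exact: sv0|exact: smooth_on_cst].
have dw0 : degree_le c 0 w0 by case.
have alt0 : parity_alternating c phi w0.
  move=> [|j] y cy /=; rewrite !mulmx0; split=> //.
  exact: (alpha_phi y _ (fv0 y)).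
have sA : smooth_on c A := smooth_conn_cartan c phi_sub.
pose W N := iter N (pencil c A) w0.
have sW N : smooth_seq c (W N) := smooth_iter_pencil N sA sw0.
have altW N : parity_alternating c phi (W N).
  by elim: N => [|N IH]; [exact: alt0|exact: (parity_pencil phi_sub (sW N) IH)].
pose U N := pair_coef (W N).
have sU N j : smooth_on c (U N j) := smooth_pair_coef j (sW N).
have orth0 i y : (i < r)%N -> cdom c y -> G i.+1 y *m phi y = 0.
  move=> ir cy; rewrite -(gauss0 G_phi).
  exact: (gauss_orthC phi_sub phi_harmonic G_phi G_iso ir (leq0n r) isT cy).
have rem0 y : cdom c y -> remainder G r y *m phi y = 0.
  move=> cy; rewrite -(gauss0 G_phi).
  exact: (remainder_gauss phi_sub phi_harmonic G_phi G_iso (leq0n r) cy).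
have subG i : subbundle (G i) := gauss_sub phi_sub G_phi i.
have <- : v0 x = v := alphav.
have K_gauss i y (u : 'cV[R[i]]_n) : second_ff (G i) (perp (G i)) c y *m u =
    second_ff (G i) (perp (G i)) c y *m (G i y *m u).
  by rewrite mulmxA (second_ff_idr _ _ _ (subG i)).
have b_gauss y (u : 'cV[R[i]]_n) : second_ff (G r) phi c y *m u =
    second_ff (G r) phi c y *m (G r y *m u).
  by rewrite mulmxA (second_ff_idr _ _ _ (subG r)).
have g_gauss y (u : 'cV[R[i]]_n) : second_ff (G r) (remainder G r) c y *m u =
    second_ff (G r) (remainder G r) c y *m (G r y *m u).
  by rewrite mulmxA (second_ff_idr _ _ _ (subG r)).
have h_rem y (u : 'cV[R[i]]_n) : cdom c y -> second_ff (remainder G r) phi c y *m u =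
    second_ff (remainder G r) phi c y *m (remainder G r y *m u).
  move=> cy; have RR := remainder_idem phi_sub phi_harmonic G_phi G_iso cy.
  by rewrite [RHS]mulmxA /second_ff -(mulmxA _ (remainder G r y) (remainder G r y)) RR.
have sC := smooth_first_return c r phi_sub G_phi.
have paths := @return_paths _ _ _ c phi G r p v0 U (gauss0 G_phi) p0 (subbundle_idem phi_sub).
rewrite -paths {paths}.
(* This is the case [t = s + 1]. The pair consists of the coefficients of index [2 t p] and
   [2 t p + 1], both above the degree bound [s]. *)
- have -> : U (s.+1 * p * r.+1 + s.+1)%N (s.+1 * p)%N x = 0; last by rewrite mulmx0.
  have big q : (s < q)%N -> W (s.+1 * p * r.+1 + s.+1)%N q x = 0.
    by move=> sq; apply: (bounded _ 0%N w0 sw0 dw0 q x _ cx).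
  have sp : (s < s.+1 * p)%N by rewrite leq_pmulr.
  by rewrite /U /pair_coef !big ?addr0 //; lia.
- by move=> y cy; rewrite /U /pair_coef /W /= addr0.
- by move=> j y cy; rewrite /U /pair_coef /W /= addr0.
- by move=> y cy; exact: (alpha_phi y _ (fv0 y)).
- exact: orth0.
- exact: rem0.
- move=> N j y cy; rewrite (pair_coefS phi_sub (sW N) (altW N) cy) -mulNmx.
  rewrite (dz_phi phi_sub phi_harmonic G_phi G_iso r0 cy) mulmxDl.
  by rewrite -(b_gauss y (U N j y)) -(h_rem y (U N j y) cy).
- move=> N j i y ir cy.
  rewrite (pair_coef_perp phi_sub (sW N) (altW N) cy j (orth0 i y ir cy)).
  rewrite (dz_gauss phi_sub phi_harmonic G_phi (sU N j) cy).
  by rewrite -(K_gauss i y (U N j y)).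
- move=> N j y cy.
  rewrite (pair_coef_perp phi_sub (sW N) (altW N) cy j (rem0 y cy)).
  rewrite (dz_remainder phi_sub phi_harmonic G_phi G_iso (sU N j) cy).
  by rewrite -(g_gauss y (U N j y)).
- move=> y cy; have fK : fibre Kerc y (v0 y) := alpha_Kerc y _ (fv0 y).
  by rewrite -fK mulmxA (filled_kernel_kill Kerc_def sC cy) mul0mx.
- by move=> y cy; exact: (first_return_pow_last phi_sub G_phi p0 Cp cy).
- by move=> y cy; exact: (first_return_pow phi_sub G_phi p0 Cp cy).
exact: cx.
Qed.
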